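(* Let $d\geq 1$, let $p\in[0,1]$ with $p<p_d=\frac{2d+1}{4d}$, let $(S_n)$ be the $d$-dimensional elephant random walk with memory parameter $p$, let $a=\frac{2dp-1}{2d-1}$, and let $G_n=\frac{1}{n}\sum_{k=1}^n S_k$. Then $$\frac{1}{\sqrt{n}}G_n\xrightarrow{\ \mathcal{L}\ }\mathcal{N}\Bigl(0,\frac{2}{3(1-2a)(2-a)d}I_d\Bigr)$$ as $n\to\infty$, where $I_d$ is the identity matrix of order $d$.
   Context: The $d$-dimensional elephant random walk (ERW) with memory parameter $p\in[0,1]$ is defined as follows. Let $e_1,\dots,e_d$ be the standard basis of $\mathbb{R}^d$; the $2d$ directions are $\pm e_1,\dots,\pm e_d$. Set $S_0=0$. The first step $X_1$ is uniformly distributed on the $2d$ directions. For $n\geq 1$, given $X_1,\dots,X_n$, an index $k$ is chosen uniformly at random in $\{1,\dots,n\}$, and then $X_{n+1}=X_k$ with probability $p$, while $X_{n+1}$ equals each of the $2d-1$ remaining directions with probability $(1-p)/(2d-1)$. The position is $S_{n+1}=S_n+X_{n+1}$. $\xrightarrow{\mathcal{L}}$ denotes convergence in distribution. *)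

(* Defs.v *)
From HB Require Import structures.
From mathcomp Require Import all_boot all_order all_algebra.
From mathcomp Require Import all_classical all_reals all_analysis.
Set Implicit Arguments. Unset Strict Implicit. Unset Printing Implicit Defensive.
Import Order.TTheory GRing.Theory Num.Theory.
Import numFieldNormedType.Exports.
Local Open Scope ring_scope.

Section ERW.
Variables (R : realType) (d : nat).

(* The 2d directions +-e_i : (i, false) is +e_i, (i, true) is -e_i. *)
Definition dir := ('I_d * bool)%type.

Definition dvec (u : dir) : 'rV[R]_d :=
  (if u.2 then -1 else 1) *: (delta_mx 0 u.1 : 'rV[R]_d).

(* Conditional law of the next step X_{m+1} = v given the history
   h = [:: X_1; ...; X_m].  For m = 0 it is uniform on the 2d directions;
   for m >= 1 an index k is uniform in {1..m} and X_{m+1} = X_k w.p. p,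
   otherwise each of the other 2d-1 directions w.p. (1-p)/(2d-1). *)
Definition erw_step (p : R) (h : seq dir) (v : dir) : R :=
  if h is [::] then (d.*2)%:R^-1
  else (size h)%:R^-1 *
       \sum_(k <- h) (if k == v then p else (1 - p) / (d.*2 - 1)%:R).

Definition erw_prob (p : R) (n : nat) (t : n.-tuple dir) : R :=
  \prod_(m < n) erw_step p (take m t) (tnth t m).

Definition erw_pos (n : nat) (t : n.-tuple dir) (k : nat) : 'rV[R]_d :=
  \sum_(j < n | (j < k)%N) dvec (tnth t j).

Definition erw_center (n : nat) (t : n.-tuple dir) : 'rV[R]_d :=
  (n%:R)^-1 *: \sum_(1 <= k < n.+1) erw_pos t k.

Definition erw_expect_scaled_center (p : R) (f : 'rV[R]_d -> R) (n : nat) : R :=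
  \sum_(t : n.-tuple dir) erw_prob p t * f ((Num.sqrt n%:R)^-1 *: erw_center t).

(* Integral of f against the centered Gaussian N(0, s^2 I_d) on R^d, whose
   density is the product of the one-dimensional N(0, s^2) densities:
   iterated integration of f, coordinate after coordinate, against
   normal_prob 0 s (s = standard deviation). *)
Fixpoint gauss_iter (s : R) (l : seq 'I_d) (f : 'rV[R]_d -> R) (x : 'rV[R]_d) : R :=
  match l with
  | [::] => f x
  | i :: l' => Rintegral (normal_prob 0 s) setT
      (fun t : R => gauss_iter s l' f (\row_j (if j == i then t else x 0 j)))
  end.

Definition gauss_expect (s : R) (f : 'rV[R]_d -> R) : R :=
  gauss_iter s (enum 'I_d) f 0.

End ERW.

(* Main.v *)
Require Import Defs.
From HB Require Import structures.
From mathcomp Require Import all_boot all_order all_algebra.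
From mathcomp Require Import all_classical all_reals all_analysis.
From mathcomp Require Import measurable_realfun.
From mathcomp Require Import ring lra.
Set Implicit Arguments. Unset Strict Implicit. Unset Printing Implicit Defensive.
Import Order.TTheory GRing.Theory Num.Theory.
Import numFieldNormedType.Exports.
Local Open Scope classical_set_scope.
Local Open Scope ring_scope.

(* Let a be the memory coefficient, so that E[X_{k+1} | X_1..X_k] = (a/k) S_k.
   For a fixed direction th, the projection of S_1 + ... + S_n on th is the last
   term of the martingale k |-> E[<th, S_1 + ... + S_n> | X_1..X_k], whose
   increments are deterministic weights times the innovations
   <th, X_{k+1}> - (a/k) <th, S_k>.  The second moments of S_n and of
   S_1 + ... + S_n satisfy linear recurrences, hence their asymptotics; the
   conditional variances concentrate because the empirical step frequencies
   obey the same kind of recurrence; and a < 1/2 makes every rescaled weight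
   negligible.  Comparing E[cos(b + martingale)] step by step with the Gaussian
   value gives the limit for trigonometric test functions, which are
   eigenfunctions of Gaussian averaging.  A bounded continuous f is approximated,
   uniformly on cubes and with the same global bound, by trigonometric
   polynomials: Bernstein polynomials in the variables (1 + sin (x_j / L)) / 2.
   Second moments control the mass outside the cubes for the walk, and dominated
   convergence does so for the Gaussian. *)

(** * Elementary bounds and linear recurrences *)

(** Write T_n = S_1 + ... + S_n. The conditional variances are random, so they cannot simply be
    factored out of E[cos]; each is replaced by its mean, at the price of a mean absolute deviation
    that tends to 0. The weights involve products of 1 + a/l, whose exact asymptotics are avoided:
    it suffices that the largest rescaled weight vanishes, being O(n^(max(a,0) - 1/2)), and that the
    rescaled squares have a bounded sum. Orthogonality of the increments gives the latter together
    with the limiting variance, since it equates E<th,T_n>^2 with the weighted sum of the innovation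
    variances. The constant comes from three recurrences of the form z_(n+1) = (1 - g_n/(n+1)) z_n +
    r_n/(n+1), whose limit is lim r_n / lim g_n. With Q = |th|^2/d they give E<th,S_n>^2 ~ Q
    n/(1-2a), then E<th,T_n><th,S_n> ~ Q n^2/((1-2a)(2-a)), then E<th,T_n>^2 ~ 2 Q
    n^3/(3(1-2a)(2-a)); the rates are 1-2a, 2-a and 3. *)

Section TaylorBounds.
Variable R : realType.
Implicit Types (f : R -> R) (t u : R).

(** Mean value theorem. Iterated below, a bound on the derivative gives the next Taylor bound with
    one more power of [|t|]; only the orders matter, so the factorials are dropped. *)
Lemma derive_bound f f' t (B : R) : (forall x : R, is_derive x 1 f (f' x)) ->
  f 0 = 0 -> (forall c, `|c| <= `|t| -> `|f' c| <= B) -> `|f t| <= B * `|t|.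
Proof.
move=> df f0 f'B.
have fc A : {within A, continuous f}.
  apply: continuous_subspaceT => x.
  by apply: differentiable_continuous; apply/derivable1_diffP; case: (df x).
have [t0|t0] := leP 0 t.
  have [c] := MVT_segment t0 (fun x _ => df x) (fc _).
  rewrite in_itv/= f0 !subr0 => /andP[c0 ct] ->.
  by rewrite normrM ler_wpM2r// f'B// !ger0_norm.
have [c] := MVT_segment (ltW t0) (fun x _ => df x) (fc _).
rewrite in_itv/= f0 !sub0r => /andP[tc c0] ft.
rewrite -normrN ft normrM normrN ler_wpM2r// f'B//.
by rewrite !ler0_norm ?lerN2// ltW.
Qed.

Lemma norm_sin_le t : `|sin t| <= `|t|.
Proof.
rewrite -[leRHS]mul1r; apply: (@derive_bound _ cos) => //.
  exact: sin0.
by move=> c _; rewrite ler_norml cos_geN1 cos_le1.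
Qed.

Lemma norm_cosB1_le t : `|cos t - 1| <= `|t| ^+ 2.
Proof.
apply: (@derive_bound (fun x => cos x - 1) (fun x => - sin x)).
- by move=> x; apply: is_derive_eq; rewrite subr0.
- by rewrite cos0 subrr.
by move=> c ct; rewrite normrN (le_trans (norm_sin_le c)).
Qed.

Lemma norm_cosB1_le1 t : `|cos t - 1| <= `|t|.
Proof.
rewrite -[leRHS]mul1r.
apply: (@derive_bound (fun x => cos x - 1) (fun x => - sin x)).
- by move=> x; apply: is_derive_eq; rewrite subr0.
- by rewrite cos0 subrr.
by move=> c _; rewrite normrN ler_norml sin_geN1 sin_le1.
Qed.

Lemma norm_subr_sin_le2 t : `|t - sin t| <= `|t| ^+ 2.
Proof.
apply: (@derive_bound (fun x => x - sin x) (fun x => 1 - cos x)).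
  by rewrite sin0 subrr.
by move=> c ct; rewrite distrC (le_trans (norm_cosB1_le1 c)).
Qed.

Lemma norm_subr_sin_le t : `|t - sin t| <= `|t| ^+ 3.
Proof.
rewrite exprSr; apply: (@derive_bound (fun x => x - sin x) (fun x => 1 - cos x)).
  by rewrite sin0 subrr.
move=> c ct; rewrite distrC (le_trans (norm_cosB1_le c))//.
by rewrite lerXn2r// ?nnegrE.
Qed.

Lemma norm_cos_taylor2_le t : `|cos t - 1 + t ^+ 2 / 2| <= `|t| ^+ 3.
Proof.
rewrite [in leRHS]exprSr.
apply: (@derive_bound (fun x => cos x - 1 + x ^+ 2 / 2) (fun x => x - sin x)).
- move=> x; apply: is_derive_eq; rewrite /GRing.scale/= !mulr1 subr0.
  by field.
- by rewrite cos0 subrr expr0n mul0r addr0.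
move=> c ct; rewrite (le_trans (norm_subr_sin_le2 c))//.
by rewrite lerXn2r// ?nnegrE.
Qed.

Lemma norm_cosD_taylor2_le u t :
  `|cos (u + t) - (cos u - t * sin u - t ^+ 2 / 2 * cos u)| <= 2 * `|t| ^+ 3.
Proof.
have -> : cos (u + t) - (cos u - t * sin u - t ^+ 2 / 2 * cos u) =
    cos u * (cos t - 1 + t ^+ 2 / 2) + sin u * (t - sin t).
  by rewrite cosD; ring.
rewrite mulr_natl mulr2n (le_trans (ler_normD _ _))// lerD// normrM.
  rewrite -[leRHS]mul1r ler_pM// ?norm_cos_taylor2_le//.
  by rewrite ler_norml cos_geN1 cos_le1.
rewrite -[leRHS]mul1r ler_pM// ?norm_subr_sin_le//.
by rewrite ler_norml sin_geN1 sin_le1.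
Qed.

Lemma expRN_taylor1_le u : 0 <= u -> `|(1 - u) - expR (- u)| <= u ^+ 2.
Proof.
move=> u0; rewrite distrC ger0_norm; last by rewrite subr_ge0 expR_ge1Dx.
have h : expR (- u) * (1 + u) <= 1.
  apply: le_trans (ler_wpM2l (expR_ge0 _) (expR_ge1Dx u)) _.
  by rewrite -expRD addNr expR0.
have e0 : 0 <= expR (- u) by exact: expR_ge0.
rewrite lerBlDr -(ler_pM2r (_ : 0 < 1 + u)); last by lra.
apply: le_trans h _.
(* (1 - u + u^2)(1 + u) = 1 + u^3. *)
have : 0 <= u ^+ 3 by rewrite exprn_ge0.
by rewrite !exprS expr0; nra.
Qed.

End TaylorBounds.

(** * Scalar recurrences with steps of order 1/n *)

Section LinearRecurrence.
Variable R : realType.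
Implicit Types (y z : nat -> R).

Lemma harmonic_unbounded (N : nat) (B : R) :
  exists2 n, (N <= n)%N & B < \sum_(N <= k < n) (k.+1)%:R^-1.
Proof.
apply: contrapT => nB; apply: (@dvg_harmonic R).
apply: nondecreasing_is_cvgn; first by apply: nondecreasing_series => n _ _; rewrite /harmonic/= invr_ge0.
exists (`|B| + \sum_(0 <= k < N) (k.+1)%:R^-1) => _ [n _ <-].
rewrite /series/= /harmonic.
have [nN|/ltnW Nn] := leqP N n.
  rewrite (big_cat_nat (leq0n N) nN)//= addrC lerD2r.
  rewrite (le_trans _ (ler_norm _))// leNgt; apply/negP => h.
  by apply: nB; exists n.
rewrite [in leRHS](big_cat_nat (leq0n n) Nn)//= addrCA lerDl addr_ge0//.
by rewrite sumr_ge0.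
Qed.

(** The sequence decreases; if it stayed above [e], step n would cost at least c e/(n+1), and the
    divergence of the harmonic series would make it negative. *)
Lemma harmonic_decay_cvg0 y (c : R) (N : nat) : 0 < c ->
  (forall n, (N <= n)%N -> 0 <= y n) ->
  (forall n, (N <= n)%N -> y n.+1 <= (1 - c / n.+1%:R) * y n) ->
  y @ \oo --> (0 : R).
Proof.
move=> c0 y0 yS.
have yB n : (N <= n)%N -> y n.+1 <= y n - c / n.+1%:R * y n.
  by move=> /yS; rewrite mulrBl mul1r.
have ydec n m : (N <= n)%N -> (n <= m)%N -> y m <= y n.
  move=> Nn; elim: m => [|m IH]; first by rewrite leqn0 => /eqP ->.
  rewrite leq_eqVlt => /orP[/eqP -> //|nm].
  have Nm : (N <= m)%N by apply: leq_trans Nn _.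
  apply: le_trans (yB _ Nm) _; apply: le_trans (IH nm).
  by rewrite gerBl mulr_ge0 ?y0// divr_ge0// ltW.
apply/cvgrPdist_le => /= e e0.
suff [n Nn yn] : exists2 n, (N <= n)%N & y n <= e.
  exists n => // m /= nm; rewrite sub0r normrN ger0_norm ?y0 ?(leq_trans Nn)//.
  exact: le_trans (ydec _ _ Nn nm) yn.
apply: contrapT => H.
have {}H n : (N <= n)%N -> e < y n.
  by move=> Nn; rewrite ltNge; apply/negP => h; apply: H; exists n.
have [n Nn] := harmonic_unbounded N (y N / (c * e)).
rewrite ltr_pdivrMr ?mulr_gt0// ltNge => /negP; apply.
suff : y n + (\sum_(N <= k < n) (k.+1)%:R^-1) * (c * e) <= y N.
  by apply: le_trans; rewrite lerDr y0.
elim: n Nn => [|n IH].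
  by rewrite leqn0 => /eqP ->; rewrite big_geq// mul0r addr0.
rewrite leq_eqVlt => /orP[/eqP -> |Nn]; first by rewrite big_geq// mul0r addr0.
rewrite big_nat_recr//= mulrDl; apply: le_trans (IH Nn).
rewrite addrCA addrC lerD2r.
have := yB n Nn; have := ltW (H _ Nn).
move=> /(ler_wpM2l (divr_ge0 (ltW c0) (ler0n R n.+1))) h1 h2.
have -> : n.+1%:R^-1 * (c * e) = c / n.+1%:R * e by rewrite mulrA [c / _]mulrC.
apply: le_trans (lerD h2 h1) _.
by rewrite subrK.
Qed.

Lemma linear_recurrence_cvg0 z (gam r : nat -> R) (g : R) : 0 < g ->
  gam @ \oo --> g -> r @ \oo --> (0 : R) ->
  (forall n, (0 < n)%N ->
     z n.+1 = (1 - gam n / n.+1%:R) * z n + r n / n.+1%:R) ->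
  z @ \oo --> (0 : R).
Proof.
move=> g0 gamg r0 zS.
apply/cvgrPdist_le => /= e e0.
have g2 : 0 < g / 2 by rewrite divr_gt0.
(* Since [gam n] is eventually at least g/2, this is at most [gam n] times e/2. *)
have eg : 0 < e * g / 4 by rewrite divr_gt0// mulr_gt0.
have [N HN] : exists N, forall n, (N <= n)%N -> [/\ (0 < n)%N, g / 2 <= gam n,
    gam n <= n.+1%:R & `|r n| <= e * g / 4].
  have [N1 _ H1] := (cvgrPdist_le _ _).1 gamg _ g2.
  have [N2 _ H2] := (cvgrPdist_le _ _).1 r0 _ eg.
  have [N3 H3] : exists N3, (2 * g <= N3%:R :> R).
    by exists (Num.truncn (2 * g)).+1; rewrite ltW// truncnS_gt.
  exists (maxn N1 (maxn N2 N3.+1)) => n; rewrite !geq_max => /and3P[n1 n2 n3].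
  have := H1 _ n1; rewrite /= ler_norml => /andP[g1 g1'].
  have : (N3%:R <= n.+1%:R :> R) by rewrite ler_nat ltnW// ltnW.
  split; [exact: leq_trans n3|lra|lra|].
  by have := H2 _ n2; rewrite /= sub0r normrN.
(* The excess of [|z n|] over e/2. The forcing term is absorbed by the contraction of the level e/2,
   so the excess obeys a homogeneous decay at rate g/2. *)
pose y n := Num.max (`|z n| - e / 2) 0.
have yc : y @ \oo --> (0 : R).
  apply: (@harmonic_decay_cvg0 y (g / 2) N) => // n Nn.
    by rewrite /y le_max lexx orbT.
  have [n0 gn gn' rn] := HN n Nn.
  have nn : 0 < n.+1%:R :> R by [].
  have y0 : 0 <= y n by rewrite /y le_max lexx orbT.
  have f0 : 0 <= 1 - gam n / n.+1%:R.
    by rewrite subr_ge0 ler_pdivrMr// mul1r.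
  have fle : 1 - gam n / n.+1%:R <= 1 - g / 2 / n.+1%:R.
    by rewrite lerD2l lerN2 ler_pM2r ?invr_gt0.
  rewrite {1}/y ge_max; apply/andP; split; last first.
    by rewrite mulr_ge0// (le_trans f0).
  apply: (@le_trans _ _ ((1 - gam n / n.+1%:R) * y n)); last exact: ler_wpM2r.
  have h1 : `|z n.+1| <= (1 - gam n / n.+1%:R) * `|z n| + `|r n| / n.+1%:R.
    rewrite zS// (le_trans (ler_normD _ _))// !normrM (ger0_norm f0).
    by rewrite normfV (ger0_norm (ler0n R _)).
  have h2 : `|z n| - e / 2 <= y n by rewrite /y le_max lexx.
  have h3 := ler_wpM2l f0 h2.
  have iv : 0 < n.+1%:R^-1 :> R by rewrite invr_gt0.
  move: h1 h3; set i := n.+1%:R^-1 in iv *; set G := gam n in gn *.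
  have h4 : `|r n| * i <= G * i * (e / 2).
    have -> : G * i * (e / 2) = (G * (e / 2)) * i by ring.
    rewrite ler_pM2r//; apply: le_trans rn _.
    have := ler_wpM2r (ltW e0) gn; lra.
  move=> h1 h3; lra.
have [N1 _ H1] := (cvgrPdist_le _ _).1 yc _ (divr_gt0 e0 (ltr0n R 2)).
exists N1 => // n /= /H1; rewrite !sub0r !normrN => h.
have : `|z n| - e / 2 <= y n by rewrite /y le_max lexx.
have := ler_norm (y n).
lra.
Qed.

Lemma linear_recurrence_cvg z (gam r : nat -> R) (g L : R) : 0 < g ->
  gam @ \oo --> g -> r @ \oo --> (0 : R) ->
  (forall n, (0 < n)%N ->
     z n.+1 - L = (1 - gam n / n.+1%:R) * (z n - L) + r n / n.+1%:R) ->
  z @ \oo --> L.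
Proof.
move=> g0 gamg r0 zS; apply/subr_cvg0.
exact: (linear_recurrence_cvg0 g0 gamg r0 zS).
Qed.

End LinearRecurrence.

(** * The Gaussian measure *)

Section GaussianCosine.
Variables (R : realType) (s : R).
Hypothesis s0 : 0 < s.
Local Notation mu := (@lebesgue_measure R).
Local Notation pdf := (normal_pdf 0 s).

Let sN0 : s != 0. Proof. by rewrite gt_eqF. Qed.

Lemma integral_normal_prob (f : R -> \bar R) :
  (normal_prob 0 s).-integrable setT f ->
  (\int[normal_prob 0 s]_x f x = \int[mu]_x (f x * (pdf x)%:E))%E.
Proof.
move=> fi.
rewrite -(Radon_Nikodym_change_of_variables (normal_prob_dominates 0 s))//=.
have mf := measurable_int _ fi.
apply: ae_eq_integral => //.
- apply: emeasurable_funM => //; apply: (measurable_int mu).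
  apply: (integrableS _ _ (@subsetT _ _)) => //=.
  by apply: Radon_Nikodym_integrable; exact: normal_prob_dominates.
- apply: emeasurable_funM => //.
  by apply/measurable_EFinP; exact: measurable_normal_pdf.
- apply: ae_eqe_mul2l => /=.
  rewrite Radon_NikodymE//=; first exact: normal_prob_dominates.
  move=> dom; case: cid => /= h [h1 h2 h3].
  apply: integral_ae_eq => //=.
  + by apply/measurable_EFinP; exact: measurable_normal_pdf.
  + by move=> E E01 mE; rewrite -h3.
Qed.

Lemma is_derive_normal_pdf (t : R) : is_derive t 1 pdf (- (t / s ^+ 2) * pdf t).
Proof.
rewrite normal_pdfE// /normal_fun; apply: is_derive_eq.
rewrite /GRing.scale/= subr0 -[s ^+ 2 *+ 2]mulr_natr; field.
by rewrite sN0.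
Qed.

Lemma normal_pdf_cvg0 (u : nat -> R) : (forall n, n%:R <= `|u n|) ->
  (fun n => pdf (u n)) @ \oo --> (0 : R).
Proof.
move=> un; rewrite normal_pdfE//; pose p := normal_peak s.
rewrite -[X in _ --> X](mulr0 p); apply: cvgMr.
apply: (@squeeze_cvgr _ _ _ _ (cst 0) (fun n => (s ^+ 2 *+ 2) * n%:R^-1)).
- near=> n; rewrite expR_ge0/= /normal_fun subr0 mulNr expRN.
  have n1 : 1 <= n%:R :> R.
    by rewrite ler1n; near: n; exact: nbhs_infty_gt.
  have n0 : 0 < n%:R :> R by rewrite (lt_le_trans ltr01).
  have ss : 0 < s ^+ 2 *+ 2 by rewrite pmulrn_lgt0// exprn_gt0.
  rewrite -[leRHS]invf_div lef_pV2 ?posrE ?expR_gt0 ?divr_gt0//.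
  apply: (@le_trans _ _ (u n ^+ 2 / (s ^+ 2 *+ 2))).
    rewrite ler_pM2r ?invr_gt0// -real_normK ?num_real// expr2.
    apply: (@le_trans _ _ (`|u n| * 1)); first by rewrite mulr1.
    by rewrite ler_wpM2l// (le_trans n1).
  by rewrite (le_trans _ (expR_ge1Dx _))// lerDr.
- exact: cvg_cst.
- rewrite -[X in _ --> X](mulr0 (s ^+ 2 *+ 2)); apply: cvgMr.
  by rewrite -cvg_shiftS; exact: cvg_harmonic.
Unshelve. all: by end_near. Qed.

Lemma integrable_bounded_normal_pdf (f : R -> R) (B : R) :
  measurable_fun setT f -> (forall x, `|f x| <= B) ->
  mu.-integrable setT (fun x => (f x * pdf x)%:E).
Proof.
move=> mf fB.
have h : mu.-integrable setT (fun x => (B%:E * (pdf x)%:E)%E).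
  by apply: integrableZl => //; exact: integrable_normal_pdf.
apply: le_integrable h => //.
  by apply/measurable_EFinP/measurable_funM => //; exact: measurable_normal_pdf.
move=> x _; rewrite -EFinM !abse_EFin lee_fin !normrM.
by rewrite ler_wpM2r// (le_trans (fB x))// ler_norm.
Qed.

(* [|t| exp(-t^2/(2 s^2)) <= s exp(-t^2/(4 s^2))], since [exp u >= 1 + u]. *)
Lemma norm_mul_normal_fun_le (t : R) :
  `|t| * normal_fun 0 s t <= s * normal_fun 0 (Num.sqrt 2 * s) t.
Proof.
rewrite /normal_fun exprMn sqr_sqrtr// subr0.
have -> : - t ^+ 2 / (s ^+ 2 *+ 2) =
    - t ^+ 2 / (2 * s ^+ 2 *+ 2) + - (t ^+ 2 / (4 * s ^+ 2)).
  by field; rewrite sN0.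
rewrite expRD mulrCA mulrC; apply: ler_wpM2r; first exact: expR_ge0.
rewrite expRN ler_pdivrMr ?expR_gt0//.
apply: (@le_trans _ _ (s * (1 + t ^+ 2 / (4 * s ^+ 2)))); last first.
  by apply: ler_wpM2l; [exact: ltW|exact: expR_ge1Dx].
have := sqr_ge0 (`|t| / 2 - s); rewrite -[t ^+ 2]real_normK ?num_real//.
set x := `|t| => h.
have -> : s * (1 + x ^+ 2 / (4 * s ^+ 2)) = x + (x / 2 - s) ^+ 2 / s.
  by field; rewrite sN0.
by rewrite lerDl divr_ge0// ltW.
Qed.

(** A Gaussian density of variance 2 s^2 absorbs the linear growth; [K] only converts between the
    two normalizations. *)
Lemma integrable_mul_normal_pdf (f : R -> R) (B : R) :
  measurable_fun setT f -> (forall x, `|f x| <= B * `|x|) -> 0 <= B ->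
  mu.-integrable setT (fun x => (f x * pdf x)%:E).
Proof.
move=> mf fB B0; pose s' := Num.sqrt 2 * s.
have s'0 : s' != 0 by rewrite mulf_neq0// gt_eqF// sqrtr_gt0.
pose K := B * normal_peak s * s / normal_peak s'.
have h : mu.-integrable setT (fun x => (K%:E * (normal_pdf 0 s' x)%:E)%E).
  by apply: integrableZl => //; exact: integrable_normal_pdf.
apply: le_integrable h => //.
  by apply/measurable_EFinP/measurable_funM => //; exact: measurable_normal_pdf.
move=> x _; rewrite -EFinM !abse_EFin lee_fin.
apply: le_trans (ler_norm _); rewrite normrM (ger0_norm (normal_pdf_ge0 _ _ _)).
rewrite !normal_pdfE//.
apply: (@le_trans _ _ (B * normal_peak s * (`|x| * normal_fun 0 s x))).
  rewrite [leRHS](_ : _ = B * `|x| * (normal_peak s * normal_fun 0 s x)); last by ring.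
  by rewrite ler_wpM2r// mulr_ge0 ?normal_peak_ge0 ?normal_fun_ge0.
rewrite [leRHS](_ : _ = B * normal_peak s * (s * normal_fun 0 s' x)); last first.
  by rewrite /K; field; rewrite gt_eqF// normal_peak_gt0.
by rewrite ler_wpM2l ?norm_mul_normal_fun_le// mulr_ge0// normal_peak_ge0.
Qed.

(** Fundamental theorem of calculus on [-n, n], then dominated convergence. *)
Lemma integral_derive_eq0 (F f : R -> R) :
  (forall x : R, is_derive x 1 F (f x)) -> continuous f ->
  mu.-integrable setT (EFin \o f) ->
  (fun n => F n%:R - F (- n%:R)) @ \oo --> (0 : R) ->
  (\int[mu]_x (f x)%:E = 0)%E.
Proof.
move=> dF cf fi F0.
pose f_ n := (EFin \o f) \_ `[- n%:R, n%:R].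
have mf := measurable_int _ fi.
have [|||||_ _] := @dominated_convergence _ _ _ mu setT measurableT
   f_ (EFin \o f) (fun x => `|(f x)%:E|)%E.
- move=> n; apply/measurable_restrict => //=.
  by apply: measurable_funS mf.
- by [].
- apply/aeW => x _; apply: cvg_near_cst; near=> n.
  rewrite /f_ patchE mem_set//= in_itv/= -ler_norml ltW//.
  by near: n; exact: nbhs_infty_gtr.
- by apply: integrable_abse.
- apply/aeW => x n _; rewrite /f_ patchE; case: ifP => // _.
  by rewrite abse0.
move=> h.
suff h0 : [sequence (\int[mu]_x f_ n x)%E]_n @ \oo --> 0%E.
  exact: (cvg_unique _ h h0).
have -> : [sequence (\int[mu]_x f_ n x)%E]_n =
    (fun n => (F n%:R - F (- n%:R))%:E).
  apply/funext => n /=; rewrite -integral_mkcond/=.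
  have [->|n0] := eqVneq n 0%N.
    by rewrite mulr0n oppr0 subrr set_itv1 integral_set1.
  have FC x : {for x, continuous F}.
    by apply: differentiable_continuous; apply/derivable1_diffP; case: (dF x).
  rewrite (@continuous_FTC2 _ f F)//.
  - by rewrite (@lt_trans _ _ 0)// ?oppr_lt0 ltr0n lt0n.
  - exact: continuous_subspaceT.
  - split; first by move=> x _; case: (dF x).
    + exact/cvg_at_right_filter/FC.
    + exact/cvg_at_left_filter/FC.
  - by move=> x _; rewrite derive1E; case: (dF x).
by apply: cvg_EFin => //; apply: nearW.
Unshelve. all: by end_near. Qed.

Lemma integrable_mul_sin_normal_pdf (th b : R) :
  mu.-integrable setT (fun x => (x * sin (th * x + b) * pdf x)%:E).
Proof.
apply: (@integrable_mul_normal_pdf _ 1) => //.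
  apply: continuous_measurable_fun => x; apply: cvgM; first exact: cvg_id.
  apply: continuous_comp; last exact: continuous_sin.
  by apply: cvgD; [apply: cvgMr; exact: cvg_id|exact: cvg_cst].
move=> x; rewrite mul1r normrM ler_piMr//.
by rewrite ler_norml sin_geN1 sin_le1.
Qed.

(** Stein's identity for sin(th x + b): the derivative of sin(th x + b) pdf(x) has integral zero. *)
Lemma normal_pdf_by_parts (th b : R) :
  \int[mu]_x (x * sin (th * x + b) * pdf x) =
  s ^+ 2 * th * \int[mu]_x (cos (th * x + b) * pdf x).
Proof.
pose F (x : R) := sin (th * x + b) * pdf x.
pose c x := th * cos (th * x + b).
pose g x := - (s ^+ 2)^-1 * (x * sin (th * x + b)).
have cl : continuous (fun x : R => th * x + b).
  move=> x; apply: cvgD; last exact: cvg_cst.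
  by apply: cvgMr; exact: cvg_id.
have csin : continuous (fun x => sin (th * x + b)).
  by move=> x; apply: continuous_comp; [exact: cl|exact: continuous_sin].
have ccos : continuous (fun x => cos (th * x + b)).
  by move=> x; apply: continuous_comp; [exact: cl|exact: continuous_cos].
have cc : continuous c by move=> x; apply: cvgMr; exact: ccos.
have cg : continuous g.
  by move=> x; apply: cvgMr; apply: cvgM; [exact: cvg_id|exact: csin].
have cp : continuous pdf by exact: continuous_normal_pdf.
have ci : mu.-integrable setT (fun x => (cos (th * x + b) * pdf x)%:E).
  apply: (@integrable_bounded_normal_pdf _ 1).
    exact: continuous_measurable_fun.
  by move=> x; rewrite ler_norml cos_geN1 cos_le1.
have xi := integrable_mul_sin_normal_pdf th b.
have E : (fun x => (c x * pdf x + g x * pdf x)%:E) = (fun x =>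
   th%:E * (cos (th * x + b) * pdf x)%:E +
   (- (s ^+ 2)^-1)%:E * (x * sin (th * x + b) * pdf x)%:E)%E.
  by apply/funext => x; rewrite -!EFinM -EFinD /c /g !mulrA.
have i0 : (\int[mu]_x (c x * pdf x + g x * pdf x)%:E = 0)%E.
  apply: (@integral_derive_eq0 F).
  - move=> x; have := is_derive_normal_pdf x => dp.
    rewrite /F /c /g; apply: is_derive_eq.
    by rewrite /GRing.scale/=; field; rewrite sN0.
  - by move=> x; apply: cvgD; apply: cvgM => //; [exact: cc|exact: cp|exact: cg|exact: cp].
  - rewrite /comp E; apply: integrableD => //; exact: integrableZl.
  - have z (u : nat -> R) : (forall n, n%:R <= `|u n|) ->
        (fun n => F (u n)) @ \oo --> (0 : R).
      move=> un; apply: norm_cvg0.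
      apply: (@squeeze_cvgr _ _ _ _ (cst 0) (fun n => pdf (u n))).
      + apply: nearW => n; rewrite normr_ge0/= /F normrM.
        rewrite (ger0_norm (normal_pdf_ge0 _ _ _)) ler_piMl ?normal_pdf_ge0//.
        by rewrite ler_norml sin_geN1 sin_le1.
      + exact: cvg_cst.
      + exact: normal_pdf_cvg0.
    rewrite -[X in _ --> X](subr0 0); apply: cvgB; apply: z => n.
      by rewrite normr_nat.
    by rewrite normrN normr_nat.
have : \int[mu]_x (th * (cos (th * x + b) * pdf x) +
    (- (s ^+ 2)^-1) * (x * sin (th * x + b) * pdf x)) = 0.
  rewrite /Rintegral.
  transitivity (fine (\int[mu]_x (c x * pdf x + g x * pdf x)%:E)%E).
    by congr fine; apply: eq_integral => x _; rewrite /c /g !mulrA.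
  by rewrite i0.
rewrite RintegralD//; last 2 first.
- by under [X in _.-integrable _ X]eq_fun do rewrite EFinM; exact: integrableZl.
- by under [X in _.-integrable _ X]eq_fun do rewrite EFinM; exact: integrableZl.
rewrite RintegralZl// RintegralZl//.
set I := \int[mu]_x _; set J := \int[mu]_x _ => h.
have : s ^+ 2 * (th * I + (- (s ^+ 2)^-1) * J) = 0 by rewrite h mulr0.
have -> : s ^+ 2 * (th * I + (- (s ^+ 2)^-1) * J) = s ^+ 2 * th * I - J.
  by field; rewrite sN0.
by move=> /eqP; rewrite subr_eq0 => /eqP ->.
Qed.

(** As a function of the frequency u, the integral solves Phi' = - s^2 u Phi: differentiating under
    the integral sign produces the left side of [normal_pdf_by_parts]. Hence [Psi] below is
    constant. The phase [b] treats sine and cosine at once. *)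
Lemma integral_cos_normal_pdf (th b : R) :
  \int[mu]_x (cos (th * x + b) * pdf x) =
  expR (- (s ^+ 2 * th ^+ 2 / 2)) * cos b.
Proof.
pose Phi th := \int[mu]_x (cos (th * x + b) * pdf x).
have ccos (u : R) : continuous (fun x : R => cos (u * x + b)).
  move=> x; apply: continuous_comp; last exact: continuous_cos.
  apply: cvgD; last exact: cvg_cst.
  by apply: cvgMr; exact: cvg_id.
have ci (u : R) : mu.-integrable setT (fun x => (cos (u * x + b) * pdf x)%:E).
  apply: (@integrable_bounded_normal_pdf _ 1).
    exact: continuous_measurable_fun.
  by move=> x; rewrite ler_norml cos_geN1 cos_le1.
pose G (x : R) := `|x| * pdf x.
have G0 (x : R) : 0 <= G x by rewrite mulr_ge0 ?normal_pdf_ge0.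
have Gi : mu.-integrable setT (EFin \o G).
  apply: (@integrable_mul_normal_pdf _ 1) => //.
  by move=> x; rewrite mul1r normr_id.
have dcos (u x : R) : is_derive u 1 (fun v => cos (v * x + b) * pdf x)
    (- (x * sin (u * x + b)) * pdf x).
  by apply: is_derive_eq; rewrite /GRing.scale/=; ring.
have dPhi (u : R) : is_derive u 1 Phi (- (s ^+ 2 * u * Phi u)).
  pose f (v x : R) := cos (v * x + b) * pdf x.
  (* Any window around u serves, because |x| pdf(x) dominates the derivative uniformly in the
     frequency. *)
  have Iu : `]u - 1, u + 1[%classic u by rewrite /= in_itv/= ltrBlDr ltrDl ltr01.
  have d1 (v x : R) : `]u - 1, u + 1[%classic v -> setT x -> derivable (f^~ x) v 1.
    by move=> _ _; case: (dcos v x).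
  have ub (v x : R) : `]u - 1, u + 1[%classic v -> setT x -> `|partial1of2 f v x| <= G x.
    move=> _ _; rewrite partial1of2E; have [_ ->] := dcos v x.
    rewrite normrM (ger0_norm (normal_pdf_ge0 _ _ _)) normrN normrM.
    rewrite ler_wpM2r ?normal_pdf_ge0// ler_piMr//.
    by rewrite ler_norml sin_geN1 sin_le1.
  have A := @derivable_under_integral R _ _ mu f setT measurableT u (u - 1) (u + 1) Iu (fun v _ => ci v) d1 G G0 Gi ub.
  have B := @differentiation_under_integral R _ _ mu f setT measurableT u (u - 1) (u + 1) Iu (fun v _ => ci v) d1 G G0 Gi ub.
  apply: DeriveDef => //; rewrite -derive1E B.
  rewrite -normal_pdf_by_parts -mulN1r -RintegralZl//; last first.
    exact: integrable_mul_sin_normal_pdf.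
  apply: eq_Rintegral => x _; rewrite partial1of2E; have [_ ->] := dcos u x.
  ring.
pose Psi (u : R) := Phi u * expR (s ^+ 2 * u ^+ 2 / 2).
have dPsi (u : R) : is_derive u 1 Psi 0.
  have := dPhi u => dP; apply: is_derive_eq; rewrite /GRing.scale/=.
  by field.
have := is_derive_0_is_cst th 0 dPsi; rewrite /Psi.
rewrite expr0n/= mulr0 mul0r expR0 mulr1.
have -> : Phi 0 = cos b.
  rewrite /Phi; under eq_Rintegral do rewrite mul0r add0r.
  rewrite RintegralZl//; last exact: integrable_normal_pdf.
  by rewrite /Rintegral integral_normal_pdf/= mulr1.
by rewrite -/(Phi th) expRN => <-; rewrite mulrC mulfK// gt_eqF// expR_gt0.
Qed.

Lemma integrable_bounded_normal_prob (f : R -> R) (B : R) :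
  measurable_fun setT f -> (forall x, `|f x| <= B) ->
  (normal_prob 0 s).-integrable setT (EFin \o f).
Proof.
move=> mf fB; apply: measurable_bounded_integrable => //.
  by rewrite /= /normal_prob integral_normal_pdf ltry.
exists B; split; first exact: num_real.
by move=> M BM x _; exact: le_trans (fB x) (ltW BM).
Qed.

Lemma Rintegral_cos_normal_prob (th b : R) :
  \int[normal_prob 0 s]_x cos (th * x + b) =
  expR (- (s ^+ 2 * th ^+ 2 / 2)) * cos b.
Proof.
rewrite -integral_cos_normal_pdf /Rintegral integral_normal_prob.
  by congr fine; apply: eq_integral => x _; rewrite EFinM.
apply: (@integrable_bounded_normal_prob _ 1).
  apply: continuous_measurable_fun => x; apply: continuous_comp; last exact: continuous_cos.
  by apply: cvgD; [apply: cvgMr; exact: cvg_id|exact: cvg_cst].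
by move=> x; rewrite ler_norml cos_geN1 cos_le1.
Qed.

End GaussianCosine.

(** * Iterated Gaussian integration of functions of several coordinates *)

Section GaussIter.
Variables (R : realType) (d : nat) (s : R).
Hypothesis s0 : 0 < s.
Implicit Types (f g : 'rV[R]_d -> R) (F : nat -> 'rV[R]_d -> R).
Implicit Types (x : 'rV[R]_d) (u : nat -> 'rV[R]_d) (i : 'I_d) (M : R).

Definition set_coord x i (t : R) : 'rV[R]_d := \row_j (if j == i then t else x 0 j).

Definition coord_cvg u x := forall j, (fun n => u n 0 j) @ \oo --> x 0 j.

(* Convergence along moving arguments covers both the continuity of one function
   (constant [F]) and the locally uniform convergence of a sequence. *)
Definition cont_cvg F f :=
  forall u x, coord_cvg u x -> (fun n => F n (u n)) @ \oo --> f x.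

(** A class stable under integration in one coordinate, by dominated convergence, and whose
    coordinate sections are integrable; sequential continuity is the form that dominated convergence
    delivers. *)
Definition bseq_cont f := cont_cvg (fun=> f) f /\ exists M, forall x, `|f x| <= M.

Lemma row_cvg (T : Type) (G : set_system T) (v : T -> 'rV[R]_d) x :
  Filter G -> (forall j, (fun t => v t 0 j) @ G --> x 0 j) -> v @ G --> x.
Proof.
move=> GF vx A [P xP PA].
have h : \forall t \near G, forall (k : 'I_1) (j : 'I_d), P k j (v t k j).
  apply: filter_forall => k; apply: filter_forall => j; rewrite (ord1 k).
  by apply: (vx j); have := xP 0 j.
by apply: filterS h => t ht; exact: PA.
Qed.

Lemma continuous_cont_cvg f : continuous f -> cont_cvg (fun=> f) f.
Proof. by move=> cf u x /row_cvg ux; apply: (cvg_comp u f ux); exact: cf. Qed.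

Lemma set_coord_cvg u x i (t_ : nat -> R) t : coord_cvg u x ->
  t_ @ \oo --> t -> coord_cvg (fun n => set_coord (u n) i (t_ n)) (set_coord x i t).
Proof.
move=> ux tt j; under eq_fun do rewrite mxE; rewrite mxE.
by case: ifP => _ //; exact: ux.
Qed.

Lemma bseq_cont_coord f x i : bseq_cont f ->
  continuous (fun t => f (set_coord x i t)).
Proof.
move=> [cf _] t; apply/(@cvg_nbhsP _ R^o) => v vt; apply: cf.
by apply: set_coord_cvg => // j; exact: cvg_cst.
Qed.

(** Convertible to the cons case of [gauss_iter], so that inductions on the list of coordinates go
    through by conversion. *)
Let gint (f : 'rV[R]_d -> R) i x :=
  \int[normal_prob 0 s]_t f (set_coord x i t).

Lemma bseq_cont_integrable f x i : bseq_cont f ->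
  (normal_prob 0 s).-integrable setT (fun t => (f (set_coord x i t))%:E).
Proof.
move=> bf; have [_ [M fM]] := bf.
apply: (@integrable_bounded_normal_prob _ _ _ M) => //.
by apply: continuous_measurable_fun; exact: bseq_cont_coord.
Qed.

Lemma gint_norm_le f i M : bseq_cont f -> (forall x, `|f x| <= M) ->
  forall x, `|gint f i x| <= M.
Proof.
move=> bf fM x; have fi := bseq_cont_integrable x i bf.
apply: le_trans (le_normr_Rintegral _ fi) _ => //.
apply: (@le_trans _ _ (\int[normal_prob 0 s]_t M)).
  apply: le_Rintegral => //.
  - exact: (integrable_abse fi).
  - by apply: (@integrable_bounded_normal_prob _ _ _ `|M|).
rewrite Rintegral_cst//.
by rewrite /= /normal_prob integral_normal_pdf/= mulr1.
Qed.

(** The constant [M] dominates, the Gaussian measure being finite. Letting the argument move with n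
    is what allows the result to be iterated. *)
Lemma gint_cont_cvg F f i M : (forall n, bseq_cont (F n)) -> bseq_cont f ->
  (forall n x, `|F n x| <= M) -> cont_cvg F f ->
  cont_cvg (fun n => gint (F n) i) (gint f i).
Proof.
move=> bF bf FM Ff u x ux.
have [|||||_ _ h] := @dominated_convergence _ _ _ (normal_prob 0 s) setT measurableT
  (fun n t => (F n (set_coord (u n) i t))%:E) (fun t => (f (set_coord x i t))%:E)
  (fun=> M%:E).
- by move=> n; apply: measurable_int (bseq_cont_integrable (u n) i (bF n)).
- by apply: measurable_int (bseq_cont_integrable x i bf).
- apply/aeW => t _; apply: cvg_EFin; first exact: nearW.
  by apply: Ff; apply: set_coord_cvg => //; exact: cvg_cst.
- by apply: (@integrable_bounded_normal_prob _ _ _ `|M|).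
- by apply/aeW => t n _; rewrite abse_EFin lee_fin.
apply: fine_cvg; rewrite fineK//.
exact: integrable_fin_num (bseq_cont_integrable x i bf).
Qed.

Lemma bseq_cont_gint f i : bseq_cont f -> bseq_cont (gint f i).
Proof.
move=> bf; have [cf [M fM]] := bf; split.
  exact: (gint_cont_cvg (fun=> bf) bf (fun=> fM)).
by exists M; exact: gint_norm_le.
Qed.

Lemma bseq_cont_gauss_iter l f : bseq_cont f -> bseq_cont (gauss_iter s l f).
Proof. by elim: l => [//|i l IH] bf; exact/(@bseq_cont_gint (gauss_iter s l f))/IH. Qed.

Lemma gauss_iter_norm_le l f M : bseq_cont f -> (forall x, `|f x| <= M) ->
  forall x, `|gauss_iter s l f x| <= M.
Proof.
move=> bf fM; elim: l => [//|i l IH].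
exact: (@gint_norm_le (gauss_iter s l f) i M (bseq_cont_gauss_iter l bf)).
Qed.

Lemma gauss_iter_cont_cvg l F f M : (forall n, bseq_cont (F n)) -> bseq_cont f ->
  (forall n x, `|F n x| <= M) -> cont_cvg F f ->
  cont_cvg (fun n => gauss_iter s l (F n)) (gauss_iter s l f).
Proof.
move=> bF bf FM Ff; elim: l => [//|i l IH].
apply: (@gint_cont_cvg (fun n => gauss_iter s l (F n)) (gauss_iter s l f) i M) => //.
- by move=> n; exact: bseq_cont_gauss_iter.
- exact: bseq_cont_gauss_iter.
- by move=> n; exact: gauss_iter_norm_le.
Qed.

Lemma bseq_contD f g : bseq_cont f -> bseq_cont g ->
  bseq_cont (fun x => f x + g x).
Proof.
move=> [cf [M fM]] [cg [N gN]]; split.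
  by move=> u x ux; apply: cvgD; [exact: cf|exact: cg].
by exists (M + N) => x; rewrite (le_trans (ler_normD _ _))// lerD.
Qed.

Lemma bseq_contZ c f : bseq_cont f -> bseq_cont (fun x => c * f x).
Proof.
move=> [cf [M fM]]; split.
  by move=> u x ux; apply: cvgMr; exact: cf.
by exists (`|c| * M) => x; rewrite normrM ler_wpM2l.
Qed.

Lemma gauss_iterD l f g x : bseq_cont f -> bseq_cont g ->
  gauss_iter s l (fun x => f x + g x) x = gauss_iter s l f x + gauss_iter s l g x.
Proof.
move=> bf bg; elim: l x => [//|i l IH] x /=.
rewrite -RintegralD//; last 2 first.
- exact: (bseq_cont_integrable x i (bseq_cont_gauss_iter l bf)).
- exact: (bseq_cont_integrable x i (bseq_cont_gauss_iter l bg)).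
by apply: eq_Rintegral => t _; rewrite IH.
Qed.

Lemma gauss_iterZ l c f x : bseq_cont f ->
  gauss_iter s l (fun x => c * f x) x = c * gauss_iter s l f x.
Proof.
move=> bf; elim: l x => [//|i l IH] x /=.
rewrite -RintegralZl//; last first.
  exact: (bseq_cont_integrable x i (bseq_cont_gauss_iter l bf)).
by apply: eq_Rintegral => t _; rewrite IH.
Qed.

Definition dotv (th x : 'rV[R]_d) : R := \sum_i th 0 i * x 0 i.

Lemma bseq_cont_cos (th : 'rV[R]_d) (b : R) :
  bseq_cont (fun x => cos (b + dotv th x)).
Proof.
split; last by exists 1 => x; rewrite ler_norml cos_geN1 cos_le1.
move=> u x ux; apply: (cvg_comp _ cos); last exact: continuous_cos.
apply: cvgD; first exact: cvg_cst.
rewrite /dotv; elim: (index_enum _) => [|j r IH].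
  by under eq_fun do rewrite big_nil; rewrite big_nil; exact: cvg_cst.
under eq_fun do rewrite big_cons; rewrite big_cons.
by apply: cvgD => //; apply: cvgMr; exact: ux.
Qed.

(** Integrating one coordinate deletes its term from the phase and contributes a factor exp(-s^2
    th_i^2/2); the coordinates outside [l] act as part of the phase. *)
Lemma gauss_iter_cos l (th : 'rV[R]_d) (b : R) x : uniq l ->
  gauss_iter s l (fun x => cos (b + dotv th x)) x =
  expR (- (s ^+ 2 * (\sum_(i <- l) th 0 i ^+ 2) / 2)) *
  cos (b + \sum_(i | i \notin l) th 0 i * x 0 i).
Proof.
elim: l x => [|i l IH] x /=.
  move=> _; rewrite big_nil mulr0 mul0r oppr0 expR0 mul1r /dotv.
  by congr (cos (_ + _)); apply: eq_bigl => i; rewrite in_nil.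
move=> /andP[il ul]; set e := expR (- (s ^+ 2 * (\sum_(j <- l) th 0 j ^+ 2) / 2)).
set b' := b + \sum_(j | j \notin i :: l) th 0 j * x 0 j.
transitivity (\int[normal_prob 0 s]_t (e * cos (th 0 i * t + b'))).
  apply: eq_Rintegral => t _; rewrite IH//; congr (_ * cos _).
  rewrite (bigD1 i)//= mxE eqxx addrCA; congr (_ + (_ + _)).
  apply: eq_big => j; first by rewrite in_cons negb_or andbC.
  by move=> /andP[_ ji]; rewrite mxE (negbTE ji).
rewrite RintegralZl//; last first.
  apply: (@integrable_bounded_normal_prob _ _ (fun t => cos (th 0 i * t + b')) 1).
    apply: continuous_measurable_fun => t.
    apply: continuous_comp; last exact: continuous_cos.
    by apply: cvgD; [apply: cvgMr; exact: cvg_id|exact: cvg_cst].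
  by move=> t; rewrite ler_norml cos_geN1 cos_le1.
rewrite Rintegral_cos_normal_prob// mulrA -expRD; congr (expR _ * _).
by rewrite big_cons; field.
Qed.

Lemma gauss_expect_cos (th : 'rV[R]_d) (b : R) :
  gauss_expect s (fun x => cos (b + dotv th x)) =
  expR (- (s ^+ 2 * (\sum_i th 0 i ^+ 2) / 2)) * cos b.
Proof.
rewrite /gauss_expect gauss_iter_cos ?enum_uniq// big_enum/=.
rewrite [X in cos (_ + X)]big_pred0 ?addr0// => i.
by rewrite mem_enum.
Qed.

End GaussIter.

(** * Trigonometric approximation *)

Section Bernstein.
Variable R : realType.
Implicit Types (phi psi : nat -> R) (t c : R) (N k : nat).

(* Mean of [phi] under the binomial law with parameters [N] and [t]. *)
Fixpoint binom_mean N phi t : R :=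
  if N is N'.+1 then t * binom_mean N' (fun k => phi k.+1) t
                     + (1 - t) * binom_mean N' phi t
  else phi 0%N.

Lemma binom_meanD N phi psi t :
  binom_mean N (fun k => phi k + psi k) t = binom_mean N phi t + binom_mean N psi t.
Proof. by elim: N phi psi => [//|N IH] phi psi /=; rewrite !IH; ring. Qed.

Lemma binom_meanZ N c phi t :
  binom_mean N (fun k => c * phi k) t = c * binom_mean N phi t.
Proof. by elim: N phi => [//|N IH] phi /=; rewrite !IH; ring. Qed.

Lemma binom_mean_cst N c t : binom_mean N (fun=> c) t = c.
Proof. by elim: N => [//|N IH] /=; rewrite !IH; ring. Qed.

(** The shift [c] carries the induction: a success replaces c by 1 + c. Taking c = -N t yields the
    binomial variance. *)
Lemma binom_mean_sqr N c t :
  binom_mean N (fun k => (k%:R + c) ^+ 2) t = (N%:R * t + c) ^+ 2 + N%:R * t * (1 - t).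
Proof.
elim: N c => [|N IH] c /=; first by rewrite !mulr0n !mul0r !add0r addr0.
have -> : (fun k => (k.+1%:R + c) ^+ 2) = (fun k => (k%:R + (1 + c)) ^+ 2).
  by apply/funext => k; rewrite -natr1 addrA.
by rewrite !IH -(natr1 N); ring.
Qed.

Lemma binom_mean_le N phi psi t : 0 <= t <= 1 ->
  (forall k, (k <= N)%N -> phi k <= psi k) ->
  binom_mean N phi t <= binom_mean N psi t.
Proof.
move=> /andP[t0 t1]; elim: N phi psi => [|N IH] phi psi le /=; first exact: le.
have t1' : 0 <= 1 - t by rewrite subr_ge0.
apply: lerD; apply: ler_wpM2l => //; apply: IH => k kN; apply: le => //.
exact: leqW.
Qed.

Lemma binom_mean_norm_le N phi t : 0 <= t <= 1 ->
  `|binom_mean N phi t| <= binom_mean N (fun k => `|phi k|) t.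
Proof.
move=> t01; rewrite ler_norml -mulN1r -binom_meanZ; apply/andP; split;
  apply: binom_mean_le => // k _; last exact: ler_norm.
by rewrite mulN1r lerNl -normrN ler_norm.
Qed.

Lemma binom_mean_dist_sqr N t : (0 < N)%N -> 0 <= t <= 1 ->
  binom_mean N (fun k => (k%:R / N%:R - t) ^+ 2) t <= N%:R^-1.
Proof.
move=> N0 /andP[t0 t1]; have N0' : N%:R != 0 :> R by rewrite pnatr_eq0 -lt0n.
have Np : 0 < N%:R :> R by rewrite ltr0n.
have -> : (fun k => (k%:R / N%:R - t) ^+ 2) =
    (fun k => N%:R ^- 2 * (k%:R + - (N%:R * t)) ^+ 2).
  by apply/funext => k; field.
rewrite binom_meanZ binom_mean_sqr.
have -> : N%:R ^- 2 * ((N%:R * t - N%:R * t) ^+ 2 + N%:R * t * (1 - t)) =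
   N%:R^-1 * (t * (1 - t)) by field.
rewrite -[leRHS]mulr1 ler_wpM2l ?invr_ge0//.
have : 0 <= (1 - t) * (1 - t) by rewrite mulr_ge0// subr_ge0.
by nra.
Qed.

End Bernstein.

(** * Trigonometric polynomials and their approximation power *)

Section TrigApproximation.
Variables (R : realType) (d : nat).
Implicit Types (f g h : 'rV[R]_d -> R) (x y z : 'rV[R]_d) (M : R).

(** Cosines with a phase suffice: the phase gives sines, frequency 0 gives constants, and
    product-to-sum formulas give products. *)
Inductive trig : ('rV[R]_d -> R) -> Prop :=
| trig_cos (th : 'rV[R]_d) (b : R) : trig (fun x => cos (b + dotv th x))
| trigD f g : trig f -> trig g -> trig (fun x => f x + g x)
| trigZ (c : R) f : trig f -> trig (fun x => c * f x).

Lemma trig_ext f g : f =1 g -> trig f -> trig g.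
Proof. by move=> /funext ->. Qed.

Lemma trig_cst (c : R) : trig (fun=> c).
Proof.
apply: (trig_ext _ (trigZ c (trig_cos 0 0))) => x /=.
rewrite /dotv big1 ?addr0 ?cos0 ?mulr1// => i _.
by rewrite mxE mul0r.
Qed.

Lemma trigM f g : trig f -> trig g -> trig (fun x => f x * g x).
Proof.
move=> tf; elim: tf g => [th b|f1 f2 _ IH1 _ IH2|c f1 _ IH] g tg; last 2 first.
- apply: (trig_ext _ (trigD (IH1 _ tg) (IH2 _ tg))) => x /=; ring.
- apply: (trig_ext _ (trigZ c (IH _ tg))) => x /=; ring.
elim: tg => [th' b'|g1 g2 _ IH1 _ IH2|c g1 _ IH]; last 2 first.
- apply: (trig_ext _ (trigD IH1 IH2)) => x /=; ring.
- apply: (trig_ext _ (trigZ c IH)) => x /=; ring.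
apply: (trig_ext _ (trigZ 2^-1 (trigD (trig_cos (th + th') (b + b'))
  (trig_cos (th - th') (b - b'))))) => x /=.
have -> : dotv (th + th') x = dotv th x + dotv th' x.
  by rewrite -big_split; apply: eq_bigr => i _; rewrite mxE mulrDl.
have -> : dotv (th - th') x = dotv th x - dotv th' x.
  by rewrite -sumrB; apply: eq_bigr => i _; rewrite !mxE mulrBl.
have -> : b + b' + (dotv th x + dotv th' x) =
  (b + dotv th x) + (b' + dotv th' x) by ring.
have -> : b - b' + (dotv th x - dotv th' x) =
  (b + dotv th x) - (b' + dotv th' x) by ring.
by rewrite cosD cosB; field.
Qed.

Lemma trig_binom_mean N (phi : nat -> 'rV[R]_d -> R) g :
  (forall k, trig (phi k)) -> trig g ->
  trig (fun x => binom_mean N (phi^~ x) (g x)).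
Proof.
move=> + tg; elim: N phi => [|N IH] phi tphi /=; first exact: tphi.
apply: trigD; apply: trigM => //.
- by apply: (IH (fun k => phi k.+1)).
- by apply: trigD; [exact: trig_cst|apply: (trig_ext _ (trigZ (-1) tg)) => x; rewrite mulN1r].
- exact: IH.
Qed.

Lemma bseq_cont_trig f : trig f -> bseq_cont f.
Proof.
elim=> [th b|g1 g2 _ h1 _ h2|c g _ hg].
- exact: bseq_cont_cos.
- exact: bseq_contD.
- exact: bseq_contZ.
Qed.

Definition unit_cube z := forall j, 0 <= z 0 j <= 1.

(* Tensor-product Bernstein operator in the coordinates listed in [l]. *)
Fixpoint bernstein N (l : seq 'I_d) h z : R :=
  if l is i :: l' then
    binom_mean N (fun k => bernstein N l' h (set_coord z i (k%:R / N%:R))) (z 0 i)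
  else h z.

Lemma unit_cube_set_coord N z i k : (0 < N)%N -> (k <= N)%N -> unit_cube z ->
  unit_cube (set_coord z i (k%:R / N%:R)).
Proof.
move=> N0 kN zc j; rewrite mxE; case: ifP => // _.
by rewrite divr_ge0//= ler_pdivrMr ?ltr0n// mul1r ler_nat.
Qed.

Lemma bernstein_norm_le N l h M z : (0 < N)%N -> (forall z, `|h z| <= M) ->
  unit_cube z -> `|bernstein N l h z| <= M.
Proof.
move=> N0 hM; elim: l z => [//|i l IH] z zc /=.
apply: le_trans (binom_mean_norm_le _ _ (zc i)) _.
rewrite -(binom_mean_cst N M (z 0 i)); apply: binom_mean_le => // k kN.
by apply: IH; exact: unit_cube_set_coord.
Qed.

(** Coordinates are averaged one at a time, each costing [e] plus c times the variance of the node
    k/N, which is at most 1/N. A quadratic modulus in the hypothesis lets the variance enter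
    directly. *)
Lemma bernstein_dist_le N l h (e c : R) z : (0 < N)%N -> 0 <= c ->
  (forall z i (t : R), unit_cube z ->
     `|h (set_coord z i t) - h z| <= e + c * (t - z 0 i) ^+ 2) ->
  unit_cube z -> `|bernstein N l h z - h z| <= (size l)%:R * (e + c / N%:R).
Proof.
move=> N0 c0 hc; elim: l z => [|i l IH] z zc /=.
  by rewrite subrr normr0 mul0r.
rewrite -[h z](binom_mean_cst N _ (z 0 i)) -mulN1r -binom_meanZ -binom_meanD.
apply: le_trans (binom_mean_norm_le _ _ (zc i)) _.
apply: (@le_trans _ _ (binom_mean N (fun k => ((size l)%:R * (e + c / N%:R) + e)
   + c * (k%:R / N%:R - z 0 i) ^+ 2) (z 0 i))).
  apply: binom_mean_le => // k kN; set z' := set_coord _ _ _.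
  have z'c : unit_cube z' by exact: unit_cube_set_coord.
  have -> : bernstein N l h z' + -1 * h z =
    (bernstein N l h z' - h z') + (h z' - h z) by ring.
  apply: le_trans (ler_normD _ _) _; rewrite -addrA lerD//.
    exact: IH.
  exact: hc.
rewrite binom_meanD binom_mean_cst binom_meanZ.
have -> : (size l).+1%:R * (e + c / N%:R) =
  (size l)%:R * (e + c / N%:R) + e + c * N%:R^-1 by rewrite -natr1; ring.
by rewrite lerD2l ler_wpM2l// binom_mean_dist_sqr.
Qed.

(** Once every coordinate of [l] is frozen at a node, [h] is evaluated at a point independent of
    [x]; what depends on [x] is the binomial weights, polynomial in the coordinates of [be x]. *)
Lemma trig_bernstein N l h (be : 'rV[R]_d -> 'rV[R]_d) :
  (forall j, trig (fun x => be x 0 j)) ->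
  (forall j, j \notin l -> forall x y, be x 0 j = be y 0 j) ->
  trig (fun x => bernstein N l h (be x)).
Proof.
elim: l be => [|i l IH] be tbe cbe /=.
  apply: (trig_ext _ (trig_cst (h (be 0)))) => x; congr h; apply/rowP => j.
  exact: cbe.
apply: (trig_binom_mean _ (phi := fun k x =>
  bernstein N l h (set_coord (be x) i (k%:R / N%:R)))) => // k.
apply: IH => j.
  have [->|ji] := eqVneq j i.
    by apply: (trig_ext _ (trig_cst (k%:R / N%:R))) => x; rewrite mxE eqxx.
  by apply: (trig_ext _ (tbe j)) => x; rewrite mxE (negbTE ji).
move=> jl x y; rewrite !mxE; case: ifP => // /negbT ji.
by apply: cbe; rewrite in_cons negb_or ji.
Qed.

(** Compactness of the cube, with half of each local radius kept for the triangle inequality. The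
    point [y] ranges over the whole space, matching the arbitrary real [t] in
    [bernstein_dist_le]. *)
Lemma continuous_unif_cube h (e : R) : continuous h -> 0 < e ->
  exists2 del : R, 0 < del & forall z y, unit_cube z ->
    (forall j, `|z 0 j - y 0 j| < del) -> `|h y - h z| < e.
Proof.
move=> ch e0.
have cK : compact [set z : 'rV[R]_d | forall j, `[0%R, 1%R]%classic (z ord0 j)].
  apply: (@rV_compact R d (fun=> `[0%R, 1%R]%classic)) => j.
  exact: segment_compact.
move/compact_near_coveringP: cK => cK.
pose P (del : R) z := forall y, (forall j, `|z 0 j - y 0 j| < del) -> `|h y - h z| < e.
have := cK R (0^'+) P _; case.
  move=> z _; have e2 : 0 < e / 2 by rewrite divr_gt0.
  have : \forall t \near z, `|h z - h t| < e / 2.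
    exact: (cvgrPdist_lt _ _).1 (ch z) _ e2.
  move=> /(nbhs_ballP z)[r /= r0 hr].
  have r2 : 0 < r / 2 by rewrite divr_gt0.
  exists (ball z (r / 2), [set del | 0 < del < r / 2]).
    split => /=; first exact: nbhsx_ballx.
    near=> del; apply/andP; split; near: del.
      exact: nbhs_right_gt.
    exact: nbhs_right_lt.
  move=> [z' del] /= [[_ zz'] /andP[del0 delr]] y z'y.
  have hz' : `|h z - h z'| < e / 2.
    apply: hr; split=> // i j; apply: le_ball (zz' i j).
    by rewrite ler_pdivrMr// ler_peMr ?ler1n// ltW.
  have hy : `|h z - h y| < e / 2.
    apply: hr; split=> // i j; rewrite [r]splitr; apply: ball_triangle (zz' i j) _.
    by rewrite (ord1 i); apply: (lt_trans (z'y j)).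
  rewrite -[h y](subrK (h z)) -addrA (le_lt_trans (ler_normD _ _))//.
  by rewrite [e]splitr ltrD// distrC.
move=> r /= r0 H; exists (r / 2); first by rewrite divr_gt0.
move=> z y zc zy; apply: (H (r / 2)) => //=.
- by rewrite sub0r normrN ger0_norm ?divr_ge0 ?ltW// ltr_pdivrMr// ltr_pMr// ltr1n.
- by rewrite divr_gt0.
Unshelve. all: by end_near. Qed.

(** The map [sig] sends the whole space periodically into the unit cube and [h] is [f] composed with
    its inverse branch near 0. Bernstein averages of [h] never exceed [M], also where [F] has ceased
    to approximate [f]. *)
Lemma trig_approx f M (K e : R) : continuous f -> (forall x, `|f x| <= M) ->
  0 < K -> 0 < e ->
  exists F, [/\ trig F, (forall x, `|F x| <= M) &
    forall x, (forall j, `|x 0 j| <= K) -> `|F x - f x| <= e].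
Proof.
(* With L = 2K, |x_j| <= K gives |x_j/L| <= 1/2, hence |sin(x_j/L)| <= 1/2: the clamping is inactive
   and arcsine inverts sine there. *)
move=> cf fM K0 e0; pose L := 2 * K.
have L0 : 0 < L by rewrite mulr_gt0.
(* [asin] is continuous only inside (-1, 1), hence the clamping. *)
pose clamp (t : R) := Num.max (- 2^-1) (Num.min (2 * t - 1) 2^-1).
have clamp_itv t : -1 < clamp t < 1.
  have h1 : 2^-1 < 1 :> R by lra.
  have h2 : - 2^-1 < 1 :> R by lra.
  by rewrite /clamp lt_max gt_max gt_min ltrN2 h1 h2 orbT.
pose inv (t : R) := L * asin (clamp t).
have cinv : continuous inv.
  move=> t; apply: cvgMr; apply: (@continuous_comp _ _ _ clamp asin).
    apply: continuous_max; first exact: cst_continuous.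
    apply: continuous_min; last exact: cst_continuous.
    by apply: cvgB; [apply: cvgMr; exact: cvg_id|exact: cvg_cst].
  exact: continuous_asin.
pose h z := f (\row_j inv (z 0 j)).
have ch : continuous h.
  move=> z; apply: (@continuous_comp _ _ _ (fun z => \row_j inv (z 0 j)) f); last exact: cf.
  apply: row_cvg => [|j]; first exact: (nbhs_filter z).
  under eq_fun do rewrite mxE; rewrite mxE.
  apply: (@continuous_comp _ _ _ (fun z : 'rV[R]_d => z 0 j) inv); last exact: cinv.
  exact: coord_continuous.
have hM z : `|h z| <= M by exact: fM.
have M0 : 0 <= M by exact: le_trans (fM 0).
pose sig x : 'rV[R]_d := \row_j ((1 + sin (L^-1 * x 0 j)) / 2).
have sigc x : unit_cube (sig x).
  move=> j; rewrite mxE; have := sin_geN1 (L^-1 * x 0 j); have := sin_le1 (L^-1 * x 0 j).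
  move: (sin _) => S; rewrite -subr_ge0 => *; apply/andP; split; lra.
have hsig x : (forall j, `|x 0 j| <= K) -> h (sig x) = f x.
  move=> xK; congr f; apply/rowP => j; rewrite !mxE /inv /clamp.
  set y := L^-1 * x 0 j.
  have y2 : `|y| <= 2^-1.
    have Li : 0 < L^-1 by rewrite invr_gt0.
    rewrite /y normrM (ger0_norm (ltW Li)) ler_pdivrMl//.
    have -> : L / 2 = K by rewrite /L; field.
    exact: xK.
  have := le_trans (norm_sin_le y) y2; rewrite ler_norml => /andP[sy1 sy2].
  have -> : 2 * ((1 + sin y) / 2) - 1 = sin y by field.
  rewrite min_l// max_r// sinK.
    by rewrite /y mulrA divff ?mul1r// gt_eqF.
  move: y2; rewrite ler_norml => /andP[y1 y2]; have := @pi_ge2 R.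
  by rewrite in_itv/= => pi2; apply/andP; split; lra.
(* Each of the d coordinates will cost at most 2 e1; d + 1 keeps the divisor positive when d = 0. *)
pose dd : R := d.+1%:R.
have dd0 : 0 < dd by rewrite ltr0n.
pose e1 := e / (2 * dd).
have e10 : 0 < e1 by rewrite divr_gt0// mulr_gt0.
have [del del0 hdel] := continuous_unif_cube ch e10.
(* Chosen so that the trivial bound 2M is below c (t - z_i)^2 as soon as |t - z_i| >= del. *)
pose c := 2 * M / del ^+ 2.
have c0 : 0 <= c by apply: divr_ge0; [rewrite mulr_ge0|exact: sqr_ge0].
have hc z i (t : R) : unit_cube z ->
    `|h (set_coord z i t) - h z| <= e1 + c * (t - z 0 i) ^+ 2.
  move=> zc; have [near|far] := ltP `|z 0 i - t| del.
    rewrite -[leLHS]addr0; apply: lerD; last first.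
      by apply: mulr_ge0 => //; exact: sqr_ge0.
    apply/ltW/hdel => // j.
    by rewrite mxE; case: ifP => [/eqP ->//|_]; rewrite subrr normr0.
  rewrite -[leLHS]add0r lerD//; first exact: ltW.
  apply: (@le_trans _ _ (2 * M)).
    by rewrite mulr_natl mulr2n (le_trans (ler_normB _ _))// lerD.
  rewrite /c mulrAC ler_pdivlMr ?exprn_gt0// ler_wpM2l ?mulr_ge0//.
  by rewrite -[X in _ <= X]real_normK ?num_real// distrC lerXn2r// ?nnegrE// ltW.
pose N := (Num.truncn (c / e1)).+1.
have N0 : (0 < N)%N by [].
have cN : c / N%:R <= e1.
  rewrite ler_pdivrMr ?ltr0n// mulrC -ler_pdivrMr// ltW//.
  exact: truncnS_gt.
exists (fun x => bernstein N (enum 'I_d) h (sig x)); split.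
- apply: trig_bernstein => j; last by rewrite mem_enum.
  under eq_fun do rewrite mxE.
  apply: (trig_ext _ (trigD (trig_cst 2^-1) (trigZ (- 2^-1)
    (trig_cos (L^-1 *: delta_mx 0 j) (pi / 2))))) => x /=.
  have -> : dotv (L^-1 *: delta_mx 0 j) x = L^-1 * x 0 j.
    rewrite /dotv (bigD1 j)//= !mxE !eqxx mulr1 big1 ?addr0// => i ij.
    by rewrite !mxE (negbTE ij) mulr0 mul0r.
  by rewrite [pi / 2 + _]addrC cosDpihalf; field.
- by move=> x; exact: bernstein_norm_le.
move=> x xK; rewrite -(hsig x xK).
apply: le_trans (bernstein_dist_le _ _ c0 hc (sigc x)) _ => //.
rewrite size_enum_ord.
apply: (@le_trans _ _ (dd * (e1 + e1))).
  apply: ler_pM => //; first by apply: addr_ge0; [exact: ltW|exact: divr_ge0].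
    by rewrite ler_nat.
  by rewrite lerD2l.
by rewrite /e1 le_eqVlt; apply/orP; left; apply/eqP; field; rewrite gt_eqF.
Qed.

End TrigApproximation.

(** * The elephant random walk *)

Section ElephantExpectation.
Variables (R : realType) (d : nat) (p : R).
Hypotheses (d0 : (0 < d)%N) (p0 : 0 <= p) (p1 : p <= 1).
Local Notation dir := (dir d).
Implicit Types (y : dir -> R) (g : seq dir -> R) (h : seq dir) (n k : nat).

Definition erw_mem : R := ((d.*2)%:R * p - 1) / (d.*2 - 1)%:R.
Local Notation a := erw_mem.

(** The integrand takes sequences rather than tuples, so that one functional of the history serves
    every length. *)
Definition erw_E n g : R := \sum_(t : n.-tuple dir) erw_prob p t * g t.

(* Conditional expectation of [y] at the next step, given the history [h]. *)
Definition erw_next h y : R := \sum_v erw_step p h v * y v.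

Definition dir_avg y : R := (\sum_u y u) / (d.*2)%:R.

Definition path_sum y h : R := \sum_(u <- h) y u.

Definition path_cumsum y h : R :=
  \sum_(1 <= k < (size h).+1) path_sum y (take k h).

Lemma card_dir : #|{: dir}| = d.*2.
Proof. by rewrite card_prod card_ord card_bool muln2. Qed.

Lemma erw_prob_rcons n (t : n.-tuple dir) v :
  erw_prob p [tuple of rcons t v] = erw_prob p t * erw_step p t v.
Proof.
rewrite /erw_prob big_ord_recr/=; congr (_ * _).
  apply: eq_bigr => i _; rewrite !(tnth_nth v)/= nth_rcons size_tuple ltn_ord.
  by rewrite -cats1 takel_cat// size_tuple ltnW.
rewrite (tnth_nth v)/= nth_rcons size_tuple ltnn eqxx.
by rewrite -cats1 takel_cat ?size_tuple// take_oversize// size_tuple.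
Qed.

(** Tower property: appending the last step is a bijection from histories of length n paired with a
    direction onto histories of length n + 1. *)
Lemma erw_E_recr n g :
  erw_E n.+1 g = erw_E n (fun h => erw_next h (fun v => g (rcons h v))).
Proof.
pose f (tv : n.-tuple dir * dir) := [tuple of rcons tv.1 tv.2].
have finj : injective f.
  move=> [t v] [t' v'] /(congr1 val)/= /eqP.
  by rewrite eqseq_rcons => /andP[/eqP/val_inj -> /eqP ->].
have fbij : bijective f.
  by apply: inj_card_bij finj _; rewrite card_prod !card_tuple expnSr.
rewrite /erw_E (reindex f)/=; last exact: onW_bij.
rewrite -(pair_bigA _ (fun t v => erw_prob p (f (t, v)) * g (f (t, v))))/=.
apply: eq_bigr => t _; rewrite /erw_next mulr_sumr; apply: eq_bigr => v _.
by rewrite erw_prob_rcons mulrA.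
Qed.

Lemma erw_E_ext n g1 g2 :
  (forall h, size h = n -> g1 h = g2 h) -> erw_E n g1 = erw_E n g2.
Proof. by move=> e; apply: eq_bigr => t _; rewrite e// size_tuple. Qed.

Lemma erw_ED n g1 g2 :
  erw_E n (fun h => g1 h + g2 h) = erw_E n g1 + erw_E n g2.
Proof. by rewrite -big_split; apply: eq_bigr => t _; rewrite mulrDr. Qed.

Lemma erw_EZ n c g : erw_E n (fun h => c * g h) = c * erw_E n g.
Proof. by rewrite /erw_E mulr_sumr; apply: eq_bigr => t _; rewrite mulrCA. Qed.

Lemma erw_EB n g1 g2 :
  erw_E n (fun h => g1 h - g2 h) = erw_E n g1 - erw_E n g2.
Proof.
rewrite -[- erw_E n g2]mulN1r -erw_EZ -erw_ED.
by apply: erw_E_ext => h _; rewrite mulN1r.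
Qed.

Lemma erw_E0 g : erw_E 0 g = g [::].
Proof.
rewrite /erw_E (big_pred1 [tuple]); last by move=> t /=; apply/esym/eqP; exact: tuple0.
by rewrite /erw_prob big_ord0 mul1r.
Qed.

Lemma erw_nextD h y1 y2 :
  erw_next h (fun v => y1 v + y2 v) = erw_next h y1 + erw_next h y2.
Proof. by rewrite -big_split; apply: eq_bigr => t _; rewrite mulrDr. Qed.

Lemma erw_nextZ h c y : erw_next h (fun v => c * y v) = c * erw_next h y.
Proof. by rewrite /erw_next mulr_sumr; apply: eq_bigr => t _; rewrite mulrCA. Qed.

Let D1 : (d.*2 - 1)%:R = (d.*2)%:R - 1 :> R.
Proof. by rewrite natrB// double_gt0. Qed.

Let D1gt0 : 0 < (d.*2)%:R - 1 :> R.
Proof. by rewrite subr_gt0 ltr1n -[2%N]/(1.*2)%N leq_double. Qed.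

Let D2gt0 : 0 < (d.*2)%:R :> R.
Proof. by rewrite ltr0n double_gt0. Qed.

Lemma erw_mem_ge : -1 <= a.
Proof.
rewrite /a D1 lerNl -mulNr ler_pdivrMr// mul1r opprB.
have : 2 <= (d.*2)%:R :> R by rewrite (ler_nat _ 2) -[2%N]/(1.*2)%N leq_double.
have := mulr_ge0 (ltW D2gt0) p0; lra.
Qed.

Lemma erw_mem_le : a <= 1.
Proof. by rewrite /a D1 ler_pdivrMr// mul1r lerD2r ler_piMr// ltW. Qed.

Lemma erw_step_ge0 h v : 0 <= erw_step p h v.
Proof.
case: h => [|u h] /=; first by rewrite invr_ge0.
rewrite mulr_ge0 ?invr_ge0// sumr_ge0// => k _; case: ifP => // _.
by rewrite divr_ge0// subr_ge0.
Qed.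

(** With c = (1-p)/(2d-1), a remembered step contributes the law a delta_k + c (counting measure),
    where a = p - c and a + 2dc = 1. The empty history obeys the same formula, its path sum being
    0. *)
Lemma erw_next_mem h y :
  erw_next h y = a / (size h)%:R * path_sum (fun u => y u - dir_avg y) h
                 + dir_avg y.
Proof.
rewrite /erw_next /dir_avg /path_sum; case: h => [|u h].
  by rewrite /= big_nil mulr0 add0r -mulr_sumr mulrC.
rewrite /erw_step; set l := u :: h; set S := \sum_u y u.
set c : R := (1 - p) / (d.*2 - 1)%:R.
have ac : a = p - c.
  by rewrite /a /c D1; field; rewrite gt_eqF.
have pc : a + c * (d.*2)%:R = 1.
  by rewrite /a /c D1; field; rewrite gt_eqF.
have one (k : dir) : \sum_v (if k == v then p else c) * y v = a * y k + c * S.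
  rewrite (bigD1 k)//= eqxx (eq_bigr (fun v => c * y v)); last first.
    by move=> v vk; rewrite eq_sym (negbTE vk).
  by rewrite -mulr_sumr /S [in RHS](bigD1 k)//= ac; ring.
transitivity ((size l)%:R^-1 * \sum_(k <- l) (a * y k + c * S)).
  under eq_bigr do rewrite -mulrA mulr_suml.
  rewrite -mulr_sumr exchange_big/=; congr (_ * _).
  by apply: eq_bigr => k _; exact: one.
rewrite (eq_bigr (fun k : dir => a * (y k - S / (d.*2)%:R) + S / (d.*2)%:R)); last first.
  move=> k _; have -> : c = (1 - a) / (d.*2)%:R.
    by rewrite -{1}pc addrAC subrr add0r mulfK// gt_eqF.
  by field; rewrite gt_eqF.
rewrite big_split/= -mulr_sumr big_const_seq iter_addr_0 count_predT.
rewrite -[_ *+ size l]mulr_natr.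
have l0 : (size l)%:R != 0 :> R by rewrite pnatr_eq0.
move: l0; rewrite /l /= -!/l; set K := (size h).+1%:R => l0.
by field; rewrite nat1r l0 gt_eqF.
Qed.

Lemma erw_next_cst h c : erw_next h (fun=> c) = c.
Proof.
have e : dir_avg (fun=> c) = c.
  by rewrite /dir_avg sumr_const card_dir -[c *+ _]mulr_natr mulfK// gt_eqF.
by rewrite erw_next_mem e /path_sum big1 ?mulr0 ?add0r// => u _; rewrite subrr.
Qed.

Lemma erw_next_centered h y : dir_avg y = 0 ->
  erw_next h y = a / (size h)%:R * path_sum y h.
Proof.
move=> e; rewrite erw_next_mem e addr0; congr (_ * _).
by apply: eq_bigr => u _; rewrite subr0.
Qed.

Lemma erw_E_cst n c : erw_E n (fun=> c) = c.
Proof.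
elim: n => [|n IH]; first by rewrite erw_E0.
by rewrite erw_E_recr -[RHS]IH; apply: erw_E_ext => h _; rewrite erw_next_cst.
Qed.

Lemma erw_prob_ge0 n (t : n.-tuple dir) : 0 <= erw_prob p t.
Proof. by apply: prodr_ge0 => i _; exact: erw_step_ge0. Qed.

Lemma erw_E_le n g1 g2 : (forall h, size h = n -> g1 h <= g2 h) ->
  erw_E n g1 <= erw_E n g2.
Proof.
move=> e; apply: ler_sum => t _; rewrite ler_wpM2l ?erw_prob_ge0//.
by rewrite e ?size_tuple.
Qed.

Lemma erw_E_ge0 n g : (forall h, size h = n -> 0 <= g h) -> 0 <= erw_E n g.
Proof. by move=> e; rewrite -(erw_E_cst n 0); exact: erw_E_le. Qed.

Lemma erw_E_norm n g : `|erw_E n g| <= erw_E n (fun h => `|g h|).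
Proof.
apply: le_trans (ler_norm_sum _ _ _) _; apply: ler_sum => t _.
by rewrite normrM ger0_norm ?erw_prob_ge0.
Qed.

Lemma erw_next_le h y1 y2 : (forall v, y1 v <= y2 v) ->
  erw_next h y1 <= erw_next h y2.
Proof. by move=> e; apply: ler_sum => v _; rewrite ler_wpM2l ?erw_step_ge0. Qed.

Lemma erw_next_norm h y : `|erw_next h y| <= erw_next h (fun v => `|y v|).
Proof.
apply: le_trans (ler_norm_sum _ _ _) _; apply: ler_sum => t _.
by rewrite normrM ger0_norm ?erw_step_ge0.
Qed.

Lemma path_sum_rcons y h v : path_sum y (rcons h v) = path_sum y h + y v.
Proof. by rewrite /path_sum -cats1 big_cat big_seq1. Qed.

Lemma path_cumsum_rcons y h v :
  path_cumsum y (rcons h v) = path_cumsum y h + (path_sum y h + y v).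
Proof.
rewrite /path_cumsum size_rcons big_nat_recr//=; congr (_ + _).
  apply: eq_big_nat => k /andP[_ kh]; rewrite -cats1 takel_cat//.
by rewrite -(size_rcons h v) take_size path_sum_rcons.
Qed.

Lemma path_sum_norm_le y B h : (forall u, `|y u| <= B) ->
  `|path_sum y h| <= (size h)%:R * B.
Proof.
move=> yB; apply: le_trans (ler_norm_sum _ _ _) _.
apply: le_trans (ler_sum _ (fun u _ => yB u)) _.
by rewrite big_const_seq iter_addr_0 count_predT mulr_natl.
Qed.

(** * Recurrences for first and second moments *)

Lemma erw_E_path_sum n y : dir_avg y = 0 -> erw_E n (path_sum y) = 0.
Proof.
move=> y0; elim: n => [|n IH]; first by rewrite erw_E0 /path_sum big_nil.
rewrite erw_E_recr -(mulr0 (1 + a / n%:R)) -IH -erw_EZ.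
apply: erw_E_ext => h sh.
rewrite (_ : (fun v => _) = (fun v => path_sum y h + y v)); last first.
  by apply/funext => v; rewrite path_sum_rcons.
by rewrite erw_nextD erw_next_cst erw_next_centered// sh; ring.
Qed.

Lemma dir_avg_center y : dir_avg (fun u => y u - dir_avg y) = 0.
Proof.
rewrite /dir_avg sumrB sumr_const card_dir -[_ *+ d.*2]mulr_natr divfK ?gt_eqF//.
by rewrite subrr mul0r.
Qed.

(** Unconditionally every step is uniform, because centred path sums have mean zero. *)
Lemma erw_E_next n y : erw_E n (fun h => erw_next h y) = dir_avg y.
Proof.
rewrite (erw_E_ext (g2 := fun h => a / n%:R *
  path_sum (fun u => y u - dir_avg y) h + dir_avg y)).
  by rewrite erw_ED erw_EZ erw_E_path_sum ?dir_avg_center// mulr0 add0r erw_E_cst.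
by move=> h sh; rewrite erw_next_mem sh.
Qed.

(** Expand the square and use that the new step has conditional mean (a/n) times the path sum. At n
    = 0 the convention 1/0 = 0 is harmless, as the old moment is 0. *)
Lemma erw_E_path_sum_sqr n y : dir_avg y = 0 ->
  erw_E n.+1 (fun h => path_sum y h ^+ 2) =
  (1 + 2 * a / n%:R) * erw_E n (fun h => path_sum y h ^+ 2)
  + dir_avg (fun u => y u ^+ 2).
Proof.
move=> y0; rewrite erw_E_recr -(erw_E_next n) -erw_EZ -erw_ED.
apply: erw_E_ext => h sh.
rewrite (_ : (fun v => _) = (fun v => path_sum y h ^+ 2 +
    (2 * path_sum y h * y v + y v ^+ 2))); last first.
  by apply/funext => v; rewrite path_sum_rcons; ring.
by rewrite !erw_nextD !erw_next_cst erw_nextZ erw_next_centered// sh; ring.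
Qed.

Lemma erw_E_path_cross n y : dir_avg y = 0 ->
  erw_E n.+1 (fun h => path_cumsum y h * path_sum y h) =
  (1 + a / n%:R) * erw_E n (fun h => path_cumsum y h * path_sum y h)
  + erw_E n.+1 (fun h => path_sum y h ^+ 2).
Proof.
move=> y0; rewrite !erw_E_recr -erw_EZ -erw_ED; apply: erw_E_ext => h sh.
rewrite (_ : (fun v => _ * _) = (fun v => path_cumsum y h * path_sum y h +
    (path_cumsum y h * y v + path_sum y (rcons h v) ^+ 2))); last first.
  by apply/funext => v; rewrite path_cumsum_rcons path_sum_rcons; ring.
by rewrite !erw_nextD !erw_next_cst erw_nextZ erw_next_centered// sh; ring.
Qed.

Lemma erw_E_path_cumsum_sqr n y : dir_avg y = 0 ->
  erw_E n.+1 (fun h => path_cumsum y h ^+ 2) =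
  erw_E n (fun h => path_cumsum y h ^+ 2)
  + (2 * (1 + a / n%:R) * erw_E n (fun h => path_cumsum y h * path_sum y h)
  + erw_E n.+1 (fun h => path_sum y h ^+ 2)).
Proof.
move=> y0; rewrite !erw_E_recr -erw_EZ -!erw_ED; apply: erw_E_ext => h sh.
rewrite (_ : (fun v => _ (rcons h v) ^+ 2) = (fun v => (path_cumsum y h ^+ 2
    + 2 * path_cumsum y h * path_sum y h) +
    (2 * path_cumsum y h * y v + path_sum y (rcons h v) ^+ 2))); last first.
  by apply/funext => v; rewrite path_cumsum_rcons path_sum_rcons; ring.
by rewrite !erw_nextD !erw_next_cst erw_nextZ erw_next_centered// sh; ring.
Qed.

Hypothesis a_lt : 2 * a < 1.

Let a1gt0 : 0 < 1 - 2 * a. Proof. by rewrite subr_gt0. Qed.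

Let a2gt0 : 0 < 2 - a.
Proof. by have := erw_mem_le; rewrite subr_gt0 => /le_lt_trans; apply; rewrite ltr1n. Qed.

Ltac field_mem :=
  generalize a1gt0 a2gt0; generalize erw_mem; intros;
  field; repeat (apply/andP; split); apply: lt0r_neq0; lra.

(** * Asymptotics of the second moments *)

Lemma erw_E_path_sum_sqr_cvg y : dir_avg y = 0 ->
  (fun n => erw_E n (fun h => path_sum y h ^+ 2) / n%:R) @ \oo -->
  dir_avg (fun u => y u ^+ 2) / (1 - 2 * a).
Proof.
move=> y0.
apply: (@linear_recurrence_cvg _ _ (fun=> 1 - 2 * a) (fun=> 0) (1 - 2 * a)).
- exact: a1gt0.
- exact: cvg_cst.
- exact: cvg_cst.
move=> n n0; rewrite /= erw_E_path_sum_sqr// -(natr1 n).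
have N0 : 0 < n%:R :> R by rewrite ltr0n.
move: n%:R N0 => N N0.
by field_mem.
Qed.

Lemma erw_E_path_cross_cvg y : dir_avg y = 0 ->
  (fun n => erw_E n (fun h => path_cumsum y h * path_sum y h) / n%:R ^+ 2)
    @ \oo --> dir_avg (fun u => y u ^+ 2) / ((1 - 2 * a) * (2 - a)).
Proof.
move=> y0.
pose gam n : R := (2 - a) + (a - 1) / n.+1%:R.
pose L := dir_avg (fun u => y u ^+ 2) / ((1 - 2 * a) * (2 - a)).
pose r n := erw_E n.+1 (fun h => path_sum y h ^+ 2) / n.+1%:R - gam n * L.
have gamc : gam @ \oo --> 2 - a.
  rewrite -[X in _ --> X]addr0 -[X in _ + X](mulr0 (a - 1)).
  by apply: cvgD; [exact: cvg_cst|apply: cvgMr; exact: cvg_harmonic].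
apply: (@linear_recurrence_cvg _ _ gam r (2 - a)) => //.
- rewrite (_ : 0 = dir_avg (fun u => y u ^+ 2) / (1 - 2 * a) - (2 - a) * L).
    apply: cvgB; last exact: cvgMl.
    have := erw_E_path_sum_sqr_cvg y0; rewrite -cvg_shiftS; exact.
  by rewrite /L; field_mem.
move=> n n0; rewrite /= erw_E_path_cross// /r /gam -/L -(natr1 n).
have N0 : 0 < n%:R :> R by rewrite ltr0n.
move: n%:R N0 => N N0.
by field_mem.
Qed.

(** The fixed point of the last recurrence for unit mean square: 3 L = 2/((1-2a)(2-a)), the right
    side being twice the limit of the normalized cross moment. *)
Definition erw_center_var : R := 2 / (3 * (1 - 2 * a) * (2 - a)).

Lemma erw_E_path_cumsum_sqr_cvg y : dir_avg y = 0 ->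
  (fun n => erw_E n (fun h => path_cumsum y h ^+ 2) / n%:R ^+ 3)
    @ \oo --> erw_center_var * dir_avg (fun u => y u ^+ 2).
Proof.
move=> y0.
pose gam n : R := 3 - 3 / n.+1%:R + n.+1%:R^-1 * n.+1%:R^-1.
pose Q := dir_avg (fun u => y u ^+ 2).
pose m n := erw_E n (fun h => path_cumsum y h * path_sum y h) / n%:R ^+ 2.
pose s n := erw_E n (fun h => path_sum y h ^+ 2) / n%:R.
pose r n := 2 * m n.+1 - s n.+1 / n.+1%:R - gam n * (erw_center_var * Q).
have hc : (fun n => n.+1%:R^-1 : R) @ \oo --> (0 : R) by exact: cvg_harmonic.
have gamc : gam @ \oo --> (3 : R).
  rewrite (_ : 3 = 3 - 3 * 0 + 0 * 0 :> R); last by ring.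
  by apply: cvgD; [apply: cvgB; [exact: cvg_cst|exact: cvgMr]|exact: cvgM].
apply: (@linear_recurrence_cvg _ _ gam r 3) => //.
- rewrite (_ : 0 = 2 * (Q / ((1 - 2 * a) * (2 - a))) - Q / (1 - 2 * a) * 0
      - 3 * (erw_center_var * Q)); last first.
    rewrite /erw_center_var.
    by field_mem.
  apply: cvgB; last exact: cvgMl.
  apply: cvgB.
    apply: cvgMr; have := erw_E_path_cross_cvg y0.
    by rewrite -cvg_shiftS; exact.
  apply: cvgM => //.
  by have := erw_E_path_sum_sqr_cvg y0; rewrite -cvg_shiftS; exact.
move=> n n0; rewrite /= erw_E_path_cumsum_sqr// /r /m /s erw_E_path_cross//.
rewrite /gam -/Q -(natr1 n); move: erw_center_var => L.
have N0 : 0 < n%:R :> R by rewrite ltr0n.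
move: n%:R N0 => N N0.
by field_mem.
Qed.

(** * Weights, martingale and conditional variances *)

Definition growth (b : R) n : R := \prod_(1 <= l < n) (1 + b / l%:R).

(** Although [growth b n] is of order n^b, no such asymptotics is needed: its square over n
    satisfies a homogeneous recurrence of limiting rate 1 - 2b. *)
Lemma growth_cvg0 (b : R) : 2 * b < 1 ->
  (fun n => growth b n ^+ 2 / n%:R) @ \oo --> (0 : R).
Proof.
move=> b2.
pose gam n : R := 1 - 2 * b - b ^+ 2 * n%:R^-1.
apply: (@linear_recurrence_cvg0 _ _ gam (fun=> 0) (1 - 2 * b)).
- lra.
- rewrite -[X in _ --> X]subr0 -[X in _ - X](mulr0 (b ^+ 2)).
  apply: cvgB; first exact: cvg_cst.
  apply: cvgMr; rewrite -cvg_shiftS; exact: cvg_harmonic.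
- exact: cvg_cst.
move=> n n0; rewrite /growth big_nat_recr//= /gam -(natr1 n).
have N0 : 0 < n%:R :> R by rewrite ltr0n.
move: n%:R N0 (\prod_(1 <= i < n) _) => N N0 P.
by  field; repeat (apply/andP; split); apply: lt0r_neq0; lra.
Qed.

(* [erw_weight n k] is the sensitivity of E[S_k + ... + S_n | X_1, ..., X_k]
   to S_k. *)
Definition erw_weight n k : R :=
  \sum_(k <= i < n.+1) \prod_(k <= l < i) (1 + a / l%:R).

Lemma erw_weight_recl n k : (k <= n)%N ->
  erw_weight n k = 1 + (1 + a / k%:R) * erw_weight n k.+1.
Proof.
move=> kn; rewrite /erw_weight big_ltn ?ltnS// big_geq//; congr (_ + _).
rewrite mulr_sumr; apply: eq_big_nat => i /andP[ki _].
by rewrite big_ltn.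
Qed.

Lemma erw_factor_ge0 k : (0 < k)%N -> 0 <= 1 + a / k%:R.
Proof.
move=> k0; rewrite -lerBlDl sub0r ler_pdivlMr ?ltr0n//.
apply: le_trans _ erw_mem_ge; rewrite mulN1r lerN2 ler1n//.
Qed.

Lemma erw_weight_ge0 n k : (0 < k)%N -> 0 <= erw_weight n k.
Proof.
move=> k0; rewrite /erw_weight big_nat sumr_ge0// => i _.
rewrite big_nat prodr_ge0// => l /andP[kl _].
by rewrite erw_factor_ge0// (leq_trans k0).
Qed.

(** Replacing [a] by max(a, 0) makes every factor at least 1, so each partial product is below the
    full one; at most n of them are summed. *)
Lemma erw_weight_le n k : (0 < k <= n)%N ->
  erw_weight n k <= n%:R * growth (Num.max a 0) n.
Proof.
move=> /andP[k0 kn]; set b := Num.max a 0.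
have b0 : 0 <= b by rewrite /b le_max lexx orbT.
have ab : a <= b by rewrite /b le_max lexx.
have f1 l : 1 <= 1 + b / l%:R by rewrite lerDl divr_ge0.
have g0 n' m : 0 <= \prod_(n' <= l < m) (1 + b / l%:R).
  by apply: prodr_ge0 => l _; rewrite (le_trans ler01).
have g1 n' m : 1 <= \prod_(n' <= l < m) (1 + b / l%:R).
  by elim/big_ind : _ => // u v u1 v1; rewrite (le_trans u1)// ler_peMr// (le_trans ler01).
have ub i : (k <= i < n.+1)%N ->
    \prod_(k <= l < i) (1 + a / l%:R) <= growth b n.
  move=> /andP[ki]; rewrite ltnS => i_n.
  apply: (@le_trans _ _ (\prod_(k <= l < i) (1 + b / l%:R))).
    rewrite !big_nat; apply: ler_prod => l /andP[kl _].
    rewrite erw_factor_ge0 ?(leq_trans k0)//= lerD2l ler_pM2r// invr_gt0 ltr0n.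
    exact: leq_trans kl.
  rewrite /growth (big_cat_nat k0 kn)/= (big_cat_nat ki i_n)/=.
  rewrite mulrCA -[leLHS]mulr1 ler_wpM2l//.
  by rewrite -[leLHS]mulr1 ler_pM// g1.
rewrite /erw_weight big_nat; apply: le_trans (ler_sum _ ub) _.
rewrite -big_nat sumr_const_nat -[leLHS]mulr_natl ler_wpM2r ?g0// ler_nat.
by rewrite leq_subLR -add1n leq_add2r.
Qed.

(** The conditional expectation of the final cumulative sum. For k <= n the coefficient of S_k
    equals [erw_weight n k - 1]; in this factored form it vanishes at k = n, where the weight is an
    empty sum. *)
Definition erw_mart y n h : R := path_cumsum y h +
  path_sum y h * ((1 + a / (size h)%:R) * erw_weight n (size h).+1).

Definition erw_incr y h v : R := y v - a / (size h)%:R * path_sum y h.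

Definition erw_cvar y h : R := erw_next h (fun v => erw_incr y h v ^+ 2).

Definition erw_var y k : R := erw_E k (erw_cvar y).

(** The recursion of the weights absorbs exactly the drift (a/k) S_k, leaving a weighted
    innovation. *)
Lemma erw_mart_rcons y n h v : (size h < n)%N ->
  erw_mart y n (rcons h v) =
  erw_mart y n h + erw_weight n (size h).+1 * erw_incr y h v.
Proof.
move=> hn; rewrite /erw_mart /erw_incr path_cumsum_rcons path_sum_rcons size_rcons.
by rewrite (erw_weight_recl hn); ring.
Qed.

Lemma erw_mart_end y n h : size h = n -> erw_mart y n h = path_cumsum y h.
Proof.
by move=> hn; rewrite /erw_mart hn /erw_weight big_geq// !mulr0 addr0.
Qed.

Lemma erw_mart_nil y n : erw_mart y n [::] = 0.
Proof. by rewrite /erw_mart /path_cumsum big_geq// /path_sum big_nil mul0r addr0. Qed.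

Lemma erw_next_incr y h : dir_avg y = 0 -> erw_next h (erw_incr y h) = 0.
Proof.
by move=> y0; rewrite erw_nextD erw_next_cst erw_next_centered// subrr.
Qed.

Lemma norm_erw_incr_le y B h v : (forall u, `|y u| <= B) ->
  `|erw_incr y h v| <= 2 * B.
Proof.
move=> yB; rewrite mulr_natl mulr2n (le_trans (ler_normB _ _))// lerD ?yB//.
rewrite normrM (normrM a) normfV (ger0_norm (ler0n R _)).
have B0 : 0 <= B by rewrite (le_trans _ (yB v)).
have [h0|h0] := posnP (size h).
  by rewrite (size0nil h0) /path_sum big_nil normr0 mulr0.
rewrite mulrAC ler_pdivrMr ?ltr0n//.
have a1 : `|a| <= 1 by rewrite ler_norml erw_mem_ge erw_mem_le.
apply: le_trans (ler_wpM2r (normr_ge0 _) a1) _.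
by rewrite mul1r mulrC path_sum_norm_le.
Qed.

Lemma erw_cvar_ge0 y h : 0 <= erw_cvar y h.
Proof. by rewrite /erw_cvar -(erw_next_cst h 0); apply: erw_next_le => v; exact: sqr_ge0. Qed.

Lemma erw_cvar_le y B h : (forall u, `|y u| <= B) -> erw_cvar y h <= (2 * B) ^+ 2.
Proof.
move=> yB; rewrite /erw_cvar -(erw_next_cst h ((2 * B) ^+ 2)).
apply: erw_next_le => v; rewrite -real_normK ?num_real// lerXn2r// ?nnegrE//.
  by rewrite (le_trans _ (norm_erw_incr_le h v yB)).
exact: norm_erw_incr_le.
Qed.

Lemma erw_var_ge0 y k : 0 <= erw_var y k.
Proof. by apply: erw_E_ge0 => h _; exact: erw_cvar_ge0. Qed.

Lemma erw_var_le y B k : (forall u, `|y u| <= B) -> erw_var y k <= (2 * B) ^+ 2.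
Proof.
move=> yB; rewrite -(erw_E_cst k ((2 * B) ^+ 2)); apply: erw_E_le => h _.
exact: erw_cvar_le.
Qed.

(** Orthogonality of martingale increments. At k = n it ties the weights to the second moment of the
    cumulative sum. *)
Lemma erw_E_mart_sqr y n k : dir_avg y = 0 -> (k <= n)%N ->
  erw_E k (fun h => erw_mart y n h ^+ 2) =
  \sum_(0 <= j < k) erw_weight n j.+1 ^+ 2 * erw_var y j.
Proof.
move=> y0; elim: k => [|k IH] kn.
  by rewrite erw_E0 erw_mart_nil expr0n big_geq.
rewrite big_nat_recr//= -IH; last exact: ltnW.
rewrite /erw_var -(erw_EZ k (_ ^+ 2)) -(erw_ED k) erw_E_recr.
apply: erw_E_ext => h hk; rewrite /erw_cvar -erw_nextZ.
rewrite (_ : (fun v => _) = (fun v => erw_mart y n h ^+ 2 +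
    (2 * erw_mart y n h * erw_weight n k.+1 * erw_incr y h v +
     erw_weight n k.+1 ^+ 2 * erw_incr y h v ^+ 2))); last first.
  by apply/funext => v; rewrite erw_mart_rcons ?hk//; ring.
by rewrite !erw_nextD erw_next_cst erw_nextZ erw_next_incr// mulr0 add0r.
Qed.

(** Conditional second moment minus squared conditional mean. The fluctuation of the former is the
    path sum of y^2 - Q, again a centred function of the steps, so the same moment estimates apply
    to it. *)
Lemma erw_cvarE y h : dir_avg y = 0 ->
  let Q := dir_avg (fun u => y u ^+ 2) in
  erw_cvar y h = Q + a / (size h)%:R * path_sum (fun u => y u ^+ 2 - Q) h
                 - (a / (size h)%:R * path_sum y h) ^+ 2.
Proof.
move=> y0 Q; rewrite /erw_cvar.
set c := a / _ * path_sum y h.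
rewrite (_ : (fun v => _) = (fun v => y v ^+ 2 + (- (2 * c) * y v + c ^+ 2))); last first.
  by apply/funext => v; rewrite /erw_incr -/c; ring.
rewrite !erw_nextD erw_nextZ erw_next_cst (erw_next_centered _ y0) -/c erw_next_mem.
by rewrite -/Q; ring.
Qed.

Lemma erw_varE y k : dir_avg y = 0 ->
  erw_var y k = dir_avg (fun u => y u ^+ 2) -
    (a / k%:R) ^+ 2 * erw_E k (fun h => path_sum y h ^+ 2).
Proof.
move=> y0; rewrite /erw_var; set Q := dir_avg _.
rewrite (erw_E_ext (g2 := fun h => Q +
   a / k%:R * path_sum (fun u => y u ^+ 2 - Q) h
    - (a / k%:R) ^+ 2 * path_sum y h ^+ 2)); last first.
  by move=> h <-; rewrite erw_cvarE// -exprMn.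
rewrite erw_EB erw_ED erw_E_cst !erw_EZ erw_E_path_sum ?mulr0 ?addr0//.
exact: dir_avg_center.
Qed.

Lemma erw_E_path_sum_sqr_cvg0 y : dir_avg y = 0 ->
  (fun k => (a / k%:R) ^+ 2 * erw_E k (fun h => path_sum y h ^+ 2)) @ \oo
    --> (0 : R).
Proof.
move=> y0.
have h1 := erw_E_path_sum_sqr_cvg y0.
have h2 : (fun n => n%:R^-1 : R) @ \oo --> (0 : R).
  rewrite -cvg_shiftS; exact: cvg_harmonic.
have := cvgM (cvgM (cvg_cst (a ^+ 2)) h1) h2; rewrite mulr0 => h3.
rewrite [X in X @ _ --> _](_ : _ = fun k => a ^+ 2 *
  (erw_E k (fun h => path_sum y h ^+ 2) / k%:R) * k%:R^-1); first exact: h3.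
by apply/funext => k; rewrite exprMn exprVn expr2 invfM; ring.
Qed.

Lemma erw_var_cvg y : dir_avg y = 0 ->
  erw_var y @ \oo --> dir_avg (fun u => y u ^+ 2).
Proof.
move=> y0; rewrite -[X in _ --> X]subr0.
rewrite (_ : erw_var y = fun k => dir_avg (fun u => y u ^+ 2) -
    (a / k%:R) ^+ 2 * erw_E k (fun h => path_sum y h ^+ 2)); last first.
  by apply/funext => k; rewrite erw_varE.
by apply: cvgB; [exact: cvg_cst|exact: erw_E_path_sum_sqr_cvg0].
Qed.

(** * Concentration of the conditional variances and comparison of cosines *)

Definition erw_dev y k : R := erw_E k (fun h => `|erw_cvar y h - erw_var y k|).

Lemma erw_dev_ge0 y k : 0 <= erw_dev y k.
Proof. by apply: erw_E_ge0 => h _. Qed.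

Lemma erw_dev_cvg0 y : dir_avg y = 0 -> erw_dev y @ \oo --> (0 : R).
Proof.
move=> y0; set Q := dir_avg (fun u => y u ^+ 2).
pose z u := y u ^+ 2 - Q.
have z0 : dir_avg z = 0 by exact: dir_avg_center.
pose sz k := (a / k%:R) ^+ 2 * erw_E k (fun h => path_sum z h ^+ 2).
pose sy k := (a / k%:R) ^+ 2 * erw_E k (fun h => path_sum y h ^+ 2).
have szc : sz @ \oo --> (0 : R) by exact: erw_E_path_sum_sqr_cvg0.
have syc : sy @ \oo --> (0 : R) by exact: erw_E_path_sum_sqr_cvg0.
(* The inequality |u| <= e + u^2/e bounds the first absolute moment by second moments. *)
have key e k : 0 < e -> erw_dev y k <= e + sz k / e + 2 * sy k.
  move=> e0.
  rewrite (_ : e + _ + _ = erw_E k (fun h =>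
     (e + e^-1 * ((a / k%:R) ^+ 2 * path_sum z h ^+ 2))
      + ((a / k%:R) ^+ 2 * path_sum y h ^+ 2 + sy k))); last first.
    by rewrite !erw_ED !erw_E_cst !erw_EZ -/(sz k) -/(sy k); ring.
  apply: erw_E_le => h hk; rewrite erw_cvarE// erw_varE// -/Q -/z -/(sy k) hk.
  rewrite -!exprMn; set u := a / _ * path_sum z h; set w := (_ * path_sum y h) ^+ 2.
  have -> : Q + u - w - (Q - sy k) = u - w + sy k by ring.
  have w0 : 0 <= w by exact: sqr_ge0.
  have s0 : 0 <= sy k by rewrite mulr_ge0 ?sqr_ge0// erw_E_ge0// => *; exact: sqr_ge0.
  have hu : `|u| <= e + e^-1 * u ^+ 2.
    have [ue|ue] := leP `|u| e.
      by rewrite (le_trans ue)// lerDl mulr_ge0 ?sqr_ge0// invr_ge0 ltW.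
    rewrite -[leLHS]add0r lerD//; first exact: ltW.
    rewrite mulrC ler_pdivlMr// -real_normK ?num_real// expr2.
    by rewrite ler_wpM2l// ltW.
  apply: le_trans (ler_normD _ _) _; rewrite (ger0_norm s0).
  have := ler_normB u w; rewrite (ger0_norm w0) => h1.
  move: hu; set E := e + _ => hu; lra.
apply/cvgrPdist_le => /= e e0.
have e2 : 0 < e / 2 by rewrite divr_gt0.
have h : (fun k => sz k / (e / 2) + 2 * sy k) @ \oo --> (0 : R).
  rewrite [X in _ --> X](_ : 0 = 0 / (e / 2) + 2 * 0); last first.
    by rewrite mul0r mulr0 addr0.
  by apply: cvgD; [exact: cvgMl|exact: cvgMr].
have [N _ HN] := (cvgrPdist_le _ _).1 h _ e2.
exists N => // k /= /HN; rewrite !sub0r !normrN => hk.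
rewrite ger0_norm ?erw_dev_ge0//; apply: le_trans (key _ k e2) _.
have := ler_norm (sz k / (e / 2) + 2 * sy k).
move: hk; set X := sz k / _ + _ => hk hX.
rewrite -addrA -/X; lra.
Qed.

(** Three errors: the cubic Taylor remainder ([h1]), the replacement of the conditional variance by
    its mean ([h2]), and that of 1 - u by exp(-u) ([h3]). The first and third are made proportional
    to q^2 [erw_var y k], so that they sum to a small multiple of the total variance. *)
Lemma erw_E_cos_step y n k (b t B : R) : dir_avg y = 0 ->
  (forall u, `|y u| <= B) -> 0 <= t -> (k < n)%N ->
  let q := t * erw_weight n k.+1 in
  let C j := erw_E j (fun h => cos (b + t * erw_mart y n h)) in
  is_true (`|C k.+1 - expR (- (q ^+ 2 * erw_var y k / 2)) * C k| <=
  q ^+ 2 * erw_dev y k + (4 * B * q + B ^+ 2 * q ^+ 2) * (q ^+ 2 * erw_var y k)).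
Proof.
move=> y0 yB t0 kn q C.
have q0 : 0 <= q by rewrite mulr_ge0// erw_weight_ge0.
have B0 : 0 <= B by rewrite (le_trans _ (yB (Ordinal d0, true))).
pose V := erw_var y k; have V0 : 0 <= V by exact: erw_var_ge0.
have VB : V <= (2 * B) ^+ 2 by exact: erw_var_le.
pose c h := cos (b + t * erw_mart y n h).
have c1 h : `|c h| <= 1 by rewrite ler_norml cos_geN1 cos_le1.
pose M := erw_E k (fun h => c h * (1 - q ^+ 2 / 2 * erw_cvar y h)).
have h1 : `|C k.+1 - M| <= 4 * B * q * (q ^+ 2 * V).
  rewrite /C erw_E_recr /M -erw_EB (le_trans (erw_E_norm _ _))//.
  rewrite mulrA -erw_EZ; apply: erw_E_le => h hk.
  pose r v := cos (b + t * erw_mart y n h + q * erw_incr y h v).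
  rewrite (_ : (fun v => _) = r); last first.
    apply/funext => v; rewrite /r erw_mart_rcons ?hk// /q; congr cos; ring.
  have -> : c h * (1 - q ^+ 2 / 2 * erw_cvar y h) = erw_next h (fun v =>
      c h + (- (q * sin (b + t * erw_mart y n h)) * erw_incr y h v
       + - (q ^+ 2 / 2 * c h) * erw_incr y h v ^+ 2)).
    rewrite !erw_nextD !erw_nextZ erw_next_cst erw_next_incr// -/(erw_cvar y h).
    by ring.
  rewrite -[- erw_next _ _]mulN1r -erw_nextZ -erw_nextD.
  apply: le_trans (erw_next_norm _ _) _.
  rewrite /erw_cvar -erw_nextZ; apply: erw_next_le => v.
  have := norm_cosD_taylor2_le (b + t * erw_mart y n h) (q * erw_incr y h v).
  rewrite -/(r v) -/(c h) => hT.
  set X := (X in `|X| <= _); set Y := (Y in `|Y| <= _) in hT.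
  have -> : X = Y by rewrite /X /Y; ring.
  apply: le_trans hT _; rewrite normrM (ger0_norm q0).
  rewrite -[erw_incr y h v ^+ 2]real_normK ?num_real//.
  have := norm_erw_incr_le h v yB; set i := `|_| => iB.
  have i0 : 0 <= i by exact: normr_ge0.
  have -> : 2 * (q * i) ^+ 3 = 2 * q ^+ 3 * i ^+ 2 * i by ring.
  have -> : 4 * B * q * q ^+ 2 * i ^+ 2 = 2 * q ^+ 3 * i ^+ 2 * (2 * B) by ring.
  by apply: ler_wpM2l iB; apply: mulr_ge0; [apply: mulr_ge0|]; rewrite ?exprn_ge0.
have h2 : `|M - (1 - q ^+ 2 * V / 2) * C k| <= q ^+ 2 * erw_dev y k.
  rewrite /M /C -erw_EZ -erw_EB (le_trans (erw_E_norm _ _))//.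
  rewrite /erw_dev -(erw_EZ k (q ^+ 2)).
  apply: erw_E_le => h hk; rewrite -/(c h) -/V.
  have -> : c h * (1 - q ^+ 2 / 2 * erw_cvar y h) - (1 - q ^+ 2 * V / 2) * c h =
    - (q ^+ 2 / 2 * (c h * (erw_cvar y h - V))) by field.
  rewrite normrN normrM (normrM (c h)) ger0_norm; last first.
    by rewrite divr_ge0// exprn_ge0.
  set D := `|erw_cvar y h - V|; have D0 : 0 <= D by exact: normr_ge0.
  have cD : `|c h| * D <= D by rewrite ler_piMl.
  apply: (@le_trans _ _ (q ^+ 2 / 2 * D)).
    by rewrite ler_wpM2l// divr_ge0// exprn_ge0.
  rewrite ler_wpM2r//; have : 0 <= q ^+ 2 by rewrite exprn_ge0.
  move: (q ^+ 2) => Q2 ?; lra.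
have h3 : `|(1 - q ^+ 2 * V / 2) * C k - expR (- (q ^+ 2 * V / 2)) * C k| <=
    B ^+ 2 * q ^+ 2 * (q ^+ 2 * V).
  have qV : 0 <= q ^+ 2 * V / 2 by rewrite divr_ge0// mulr_ge0// exprn_ge0.
  rewrite -mulrBl normrM.
  have C1 : `|C k| <= 1.
    rewrite (le_trans (erw_E_norm _ _))// -(erw_E_cst k 1).
    by apply: erw_E_le => h _; exact: c1.
  apply: (@le_trans _ _ ((q ^+ 2 * V / 2) ^+ 2)).
    by rewrite -[leRHS]mulr1 ler_pM// expRN_taylor1_le.
  have -> : (q ^+ 2 * V / 2) ^+ 2 = q ^+ 2 * (q ^+ 2 * V) / 4 * V by field.
  have -> : B ^+ 2 * q ^+ 2 * (q ^+ 2 * V) =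
     q ^+ 2 * (q ^+ 2 * V) / 4 * (2 * B) ^+ 2 by field.
  apply: ler_wpM2l VB; apply: divr_ge0 => //.
  by apply: mulr_ge0; [|apply: mulr_ge0 => //]; exact: exprn_ge0.
rewrite -/V.
have -> : C k.+1 - expR (- (q ^+ 2 * V / 2)) * C k = (C k.+1 - M) +
  (M - (1 - q ^+ 2 * V / 2) * C k) +
  ((1 - q ^+ 2 * V / 2) * C k - expR (- (q ^+ 2 * V / 2)) * C k) by ring.
apply: le_trans (ler_normD _ _) _.
apply: le_trans (lerD (ler_normD _ _) (lexx _)) _.
apply: le_trans (lerD (lerD h1 h2) h3) _.
by rewrite le_eqVlt; apply/orP; left; apply/eqP; ring.
Qed.

(** The Gaussian factors are at most 1, so the one-step errors merely add up; the product of the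
    factors has exponent -v/2 by [erw_E_mart_sqr]. *)
Lemma erw_E_cos_le y n (b t B m : R) : dir_avg y = 0 ->
  (forall u, `|y u| <= B) -> 0 <= t ->
  (forall k, (k < n)%N -> t * erw_weight n k.+1 <= m) ->
  let v := t ^+ 2 * erw_E n (fun h => path_cumsum y h ^+ 2) in
  is_true (
  `|erw_E n (fun h => cos (b + t * path_cumsum y h)) - expR (- (v / 2)) * cos b|
  <= \sum_(0 <= k < n) (t * erw_weight n k.+1) ^+ 2 * erw_dev y k
     + (4 * B * m + B ^+ 2 * m ^+ 2) * v).
Proof.
move=> y0 yB t0 wm v.
pose C j := erw_E j (fun h => cos (b + t * erw_mart y n h)).
have B0 : 0 <= B by rewrite (le_trans _ (yB (Ordinal d0, true))).
pose W j := \sum_(0 <= k < j) (t * erw_weight n k.+1) ^+ 2 * erw_var y k.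
have Wn : v = W n.
  rewrite /v /W (erw_E_ext (g2 := fun h => erw_mart y n h ^+ 2)); last first.
    by move=> h hn; rewrite erw_mart_end.
  rewrite erw_E_mart_sqr// mulr_sumr; apply: eq_bigr => j _.
  by rewrite exprMn mulrA.
have -> : erw_E n (fun h => cos (b + t * path_cumsum y h)) = C n.
  by apply: erw_E_ext => h hn; rewrite erw_mart_end.
rewrite Wn.
suff : forall j, (j <= n)%N -> `|C j - expR (- (W j / 2)) * cos b| <=
    \sum_(0 <= k < j) (t * erw_weight n k.+1) ^+ 2 * erw_dev y k
     + (4 * B * m + B ^+ 2 * m ^+ 2) * W j by apply.
elim=> [_|j IH jn].
  rewrite /C erw_E0 erw_mart_nil mulr0 addr0 /W !big_geq//.
  by rewrite mul0r oppr0 expR0 mul1r subrr normr0 mulr0 addr0.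
set D := 4 * B * m + _ in IH *.
have := erw_E_cos_step b y0 yB t0 jn; set q := t * _ => /=.
rewrite -/(C j) -/(C j.+1).
set X := q ^+ 2 * erw_var y j; set F := expR _ => h1.
have q0 : 0 <= q by rewrite mulr_ge0// erw_weight_ge0.
have qm : q <= m by exact: wm.
have X0 : 0 <= X by rewrite mulr_ge0 ?erw_var_ge0// exprn_ge0.
have h2 : (4 * B * q + B ^+ 2 * q ^+ 2) * X <= D * X.
  rewrite ler_wpM2r// lerD// ler_wpM2l// ?exprn_ge0 ?mulr_ge0//.
  by rewrite lerXn2r// nnegrE (le_trans q0).
have F0 : 0 <= F by exact: expR_ge0.
have F1 : F <= 1 by rewrite -expR0 ler_expR oppr_le0 divr_ge0.
rewrite /W !big_nat_recr//= -/(W j) -/q -/X.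
have -> : expR (- ((W j + X) / 2)) = F * expR (- (W j / 2)).
  by rewrite /F -expRD; congr expR; ring.
set G := expR _ * cos b in IH; set S := \sum_(0 <= k < j) _ in IH *.
have -> : C j.+1 - F * expR (- (W j / 2)) * cos b =
  (C j.+1 - F * C j) + F * (C j - G) by rewrite /G; ring.
apply: le_trans (ler_normD _ _) _; rewrite normrM (ger0_norm F0).
have h3 : F * `|C j - G| <= S + D * W j.
  by apply: le_trans (IH (ltnW jn)); rewrite ler_piMl.
apply: le_trans (lerD h1 h3) _.
move: h2; rewrite mulrDr; set Y := _ * X; set Z := D * X; set T := q ^+ 2 * _.
by set Z' := D * W j; clear; move=> ?; lra.
Qed.

(** * Weights rescaled by n^(-3/2) *)

Definition center_scale n : R := (Num.sqrt n%:R)^-1 * n%:R^-1.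

Lemma center_scale_ge0 n : 0 <= center_scale n.
Proof. by rewrite mulr_ge0 ?invr_ge0 ?sqrtr_ge0. Qed.

Lemma center_scale_sqr n : center_scale n ^+ 2 = (n%:R ^+ 3)^-1.
Proof. by rewrite exprMn !exprVn sqr_sqrtr// -invfM -exprS. Qed.

(** This is growth / sqrt n, written so that [growth_cvg0] applies under the root. *)
Definition max_weight n : R := Num.sqrt (growth (Num.max a 0) n ^+ 2 / n%:R).

Lemma scaled_weight_le n k : (k < n)%N ->
  center_scale n * erw_weight n k.+1 <= max_weight n.
Proof.
move=> kn; have n0 : (0 < n)%N by exact: leq_ltn_trans kn.
have h : (0 < k.+1 <= n)%N by rewrite kn.
apply: le_trans (ler_wpM2l (center_scale_ge0 n) (erw_weight_le h)) _.
have g0 : 0 <= growth (Num.max a 0) n.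
  apply: prodr_ge0 => l _; rewrite addr_ge0// divr_ge0//.
  by rewrite le_max lexx orbT.
rewrite /max_weight sqrtrM ?sqr_ge0// sqrtr_sqr ger0_norm// sqrtrV//.
rewrite /center_scale mulrA -(mulrA _ n%:R^-1) mulVf ?mulr1; last first.
  by rewrite pnatr_eq0 -lt0n.
by rewrite mulrC.
Qed.

(** Both a and 0 are below 1/2, hence so is their maximum. *)
Lemma max_weight_cvg0 : max_weight @ \oo --> (0 : R).
Proof.
rewrite -[X in _ --> X](sqrtr0 R).
apply: (cvg_comp _ Num.sqrt); last exact: sqrt_continuous.
by apply: growth_cvg0; rewrite /Num.max; case: ifP => _ //.
Qed.

Lemma max_weight_sqr_cvg0 : (fun n => max_weight n ^+ 2) @ \oo --> (0 : R).
Proof.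
rewrite -[X in _ --> X](mulr0 0); under eq_fun do rewrite expr2.
by apply: cvgM; exact: max_weight_cvg0.
Qed.

(** Toeplitz splitting: before [K] each term is at most m H, afterwards [f] is below [g]. *)
Lemma weighted_sum_le n K (m H : R) (q f g : nat -> R) :
  (forall k, (k < n)%N -> 0 <= q k <= m) -> (forall k, f k <= H) -> 0 <= H ->
  (forall k, 0 <= g k) -> (forall k, (K <= k)%N -> f k <= g k) -> 0 <= m ->
  \sum_(0 <= k < n) q k * f k <= K%:R * (m * H) + \sum_(0 <= k < n) q k * g k.
Proof.
move=> qm fH H0 g0 fg m0.
have -> : K%:R * (m * H) = \sum_(0 <= k < K) m * H.
  by rewrite sumr_const_nat subn0 mulr_natl.
elim: n qm => [|n IH] qm.
  rewrite big_geq// [X in _ <= _ + X]big_geq// addr0.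
  by rewrite sumr_ge0// => k _; rewrite mulr_ge0.
have [nK|Kn] := ltnP n K.
  have mono : \sum_(0 <= k < n.+1) m * H <= \sum_(0 <= k < K) m * H.
    rewrite (big_cat_nat (leq0n _) nK)/= lerDl sumr_ge0// => k _.
    by rewrite mulr_ge0.
  apply: le_trans (lerD mono (lexx _)); rewrite -big_split/= !big_nat.
  apply: ler_sum => k /andP[_ kn]; have /andP[q0 qm'] := qm k kn.
  apply: (@le_trans _ _ (q k * H)); first by rewrite ler_wpM2l.
  by rewrite -[leLHS]addr0 lerD ?mulr_ge0// ler_wpM2r.
rewrite !big_nat_recr//= addrA lerD//.
  by apply: IH => k kn; apply: qm; exact: ltnW.
by have /andP[q0 _] := qm n (ltnSn n); rewrite ler_wpM2l// fg.
Qed.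

Lemma scaled_var_cvg y : dir_avg y = 0 ->
  (fun n => center_scale n ^+ 2 * erw_E n (fun h => path_cumsum y h ^+ 2)) @ \oo
    --> erw_center_var * dir_avg (fun u => y u ^+ 2).
Proof.
move=> /erw_E_path_cumsum_sqr_cvg.
by under eq_fun do rewrite mulrC -center_scale_sqr.
Qed.

(** The weights do not depend on [y], so one convenient test function decides: for the sign [x],
    centred of mean square 1, the innovation variances tend to 1, and the sum weighted by them is a
    convergent second moment. *)
Lemma scaled_weight_sum_bounded : exists C, forall n,
  \sum_(0 <= k < n) (center_scale n * erw_weight n k.+1) ^+ 2 <= C.
Proof.
pose x (u : dir) : R := if u.2 then -1 else 1.
have x0 : dir_avg x = 0.
  rewrite /dir_avg /x.
  rewrite -(pair_bigA _ (fun (_ : 'I_d) (b : bool) => if b then -1 else 1))/=.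
  by rewrite big1 ?mul0r// => i _; rewrite big_bool/= addrC subrr.
have xx : dir_avg (fun u => x u ^+ 2) = 1.
  rewrite /dir_avg (eq_bigr (fun=> 1)).
    by rewrite sumr_const card_dir divff// gt_eqF.
  by move=> [i []] _; rewrite /x/= ?sqrrN expr1n.
have [K _ HK] : \forall k \near \oo, 1 <= 2 * erw_var x k.
  have := erw_var_cvg x0; rewrite xx => /cvgrPdist_le /(_ (2^-1)).
  have h2 : 0 < 2^-1 :> R by rewrite invr_gt0.
  move=> /(_ h2); apply: filterS => k; rewrite ler_norml => /andP[_].
  rewrite lerBlDr -lerBlDl; set v := erw_var x k => h.
  suff : 2^-1 <= v by lra.
  by apply: le_trans h; rewrite -lerBlDr; lra.
have [C1 hC1] : exists C, forall n, max_weight n ^+ 2 <= C.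
  have h : cvgn (fun n => max_weight n ^+ 2).
    by apply/cvg_ex; exists 0; exact: max_weight_sqr_cvg0.
  have [C [_ hC]] := cvg_seq_bounded h.
  exists (C + 1) => n; apply: le_trans (ler_norm _) _; apply: hC => //.
  by rewrite ltrDl.
have [C2 hC2] : exists C, forall n,
    center_scale n ^+ 2 * erw_E n (fun h => path_cumsum x h ^+ 2) <= C.
  have h : cvgn (fun n => center_scale n ^+ 2 *
      erw_E n (fun h => path_cumsum x h ^+ 2)).
    by apply/cvg_ex; eexists; exact: scaled_var_cvg.
  have [C [_ hC]] := cvg_seq_bounded h.
  exists (C + 1) => n; apply: le_trans (ler_norm _) _; apply: hC => //.
  by rewrite ltrDl.
exists (K%:R * (C1 * 1) + 2 * C2) => n.
pose q k := (center_scale n * erw_weight n k.+1) ^+ 2.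
have qm k : (k < n)%N -> 0 <= q k <= C1.
  move=> kn; rewrite sqr_ge0/=; apply: le_trans (hC1 n).
  have w0 : 0 <= center_scale n * erw_weight n k.+1.
    by rewrite mulr_ge0 ?center_scale_ge0 ?erw_weight_ge0.
  by rewrite lerXn2r// ?nnegrE ?sqrtr_ge0// scaled_weight_le.
have := @weighted_sum_le n K C1 1 q (fun=> 1) (fun k => 2 * erw_var x k) qm.
move=> /(_ (fun=> lexx _) ler01) => h.
have g0 k : 0 <= 2 * erw_var x k by rewrite mulr_ge0 ?erw_var_ge0.
have {}h := h g0 HK (le_trans (sqr_ge0 _) (hC1 n)).
rewrite (eq_bigr (fun k => q k * 1)); last by move=> k _; rewrite mulr1.
apply: le_trans h _; rewrite lerD2l.
under eq_bigr do rewrite mulrCA.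
rewrite -mulr_sumr ler_wpM2l//; apply: le_trans (hC2 n).
rewrite (erw_E_ext (g2 := fun h => erw_mart x n h ^+ 2)); last first.
  by move=> h hn; rewrite erw_mart_end.
rewrite erw_E_mart_sqr// mulr_sumr le_eqVlt; apply/orP; left; apply/eqP.
by apply: eq_bigr => k _; rewrite /q exprMn mulrA.
Qed.

Lemma scaled_weight_sum_cvg0 (f : nat -> R) : (forall k, 0 <= f k) ->
  f @ \oo --> (0 : R) ->
  (fun n => \sum_(0 <= k < n) (center_scale n * erw_weight n k.+1) ^+ 2 * f k)
    @ \oo --> (0 : R).
Proof.
move=> f0 fc; have [C hC] := scaled_weight_sum_bounded.
have C0 : 0 <= C by have := hC 0%N; rewrite big_geq.
have [H H0 fH] : exists2 H, 0 <= H & forall k, f k <= H.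
  have h : cvgn f by apply/cvg_ex; exists 0.
  have [H [_ hH]] := cvg_seq_bounded h.
  have ub k : f k <= H + 1.
    by apply: le_trans (ler_norm _) _; apply: hH => //; rewrite ltrDl.
  by exists (H + 1) => //; exact: le_trans (ub 0%N).
apply/cvgrPdist_le => /= e e0.
(* C + 1 rather than C, which may be 0. *)
pose e1 := e / (2 * (C + 1)).
have C1 : 0 < C + 1 by rewrite ltr_wpDl.
have e10 : 0 < e1 by rewrite divr_gt0// mulr_gt0.
have [K _ HK] := (cvgrPdist_le _ _).1 fc _ e10.
have mc : (fun n => K%:R * (max_weight n ^+ 2 * H)) @ \oo --> (0 : R).
  rewrite -[X in _ --> X](mulr0 K%:R); apply: cvgMr.
  rewrite -[X in _ --> X](mul0r H); apply: cvgMl.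
  exact: max_weight_sqr_cvg0.
have e2 : 0 < e / 2 by rewrite divr_gt0.
have [N _ HN] := (cvgrPdist_le _ _).1 mc _ e2.
exists N => // n /= /HN; rewrite !sub0r !normrN => hn.
rewrite ger0_norm; last first.
  by rewrite sumr_ge0// => k _; rewrite mulr_ge0 ?sqr_ge0.
pose q k := (center_scale n * erw_weight n k.+1) ^+ 2.
have qm k : (k < n)%N -> 0 <= q k <= max_weight n ^+ 2.
  move=> kn; rewrite sqr_ge0/=.
  have w0 : 0 <= center_scale n * erw_weight n k.+1.
    by rewrite mulr_ge0 ?center_scale_ge0 ?erw_weight_ge0.
  by rewrite lerXn2r// ?nnegrE ?sqrtr_ge0// scaled_weight_le.
have fe k : (K <= k)%N -> f k <= e1.
  by move=> /HK /=; rewrite sub0r normrN ger0_norm.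
apply: le_trans (weighted_sum_le qm fH H0 (fun=> ltW e10) fe (sqr_ge0 _)) _.
rewrite -mulr_suml; have := ler_norm (K%:R * (max_weight n ^+ 2 * H)).
have : (\sum_(0 <= k < n) q k) * e1 <= e / 2.
  apply: (@le_trans _ _ ((C + 1) * e1)).
    by rewrite ler_wpM2r ?ltW// (le_lt_trans (hC n))// ltrDl.
  by rewrite le_eqVlt; apply/orP; left; apply/eqP; rewrite /e1; field; rewrite gt_eqF.
move: hn; set X := K%:R * _; set Y := _ * e1; move=> ? ? ?; lra.
Qed.

Lemma erw_E_cos_cvg y (b : R) : dir_avg y = 0 ->
  (fun n => erw_E n (fun h => cos (b + center_scale n * path_cumsum y h)))
    @ \oo -->
  expR (- (erw_center_var * dir_avg (fun u => y u ^+ 2) / 2)) * cos b.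
Proof.
move=> y0.
pose B := \sum_u `|y u|.
have yB u : `|y u| <= B by rewrite /B (bigD1 u)//= lerDl sumr_ge0.
pose v n := center_scale n ^+ 2 * erw_E n (fun h => path_cumsum y h ^+ 2).
have vc : v @ \oo --> erw_center_var * dir_avg (fun u => y u ^+ 2).
  exact: scaled_var_cvg.
have h1 : (fun n => expR (- (v n / 2)) * cos b) @ \oo -->
    expR (- (erw_center_var * dir_avg (fun u => y u ^+ 2) / 2)) * cos b.
  apply: cvgMl; apply: (cvg_comp _ expR); last exact: continuous_expR.
  by apply: cvgN; exact: cvgMl.
rewrite -[X in _ --> X]add0r.
rewrite [X in X @ _ --> _](_ : _ = fun n =>
   (erw_E n (fun h => cos (b + center_scale n * path_cumsum y h))
    - expR (- (v n / 2)) * cos b) + expR (- (v n / 2)) * cos b); last first.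
  by apply/funext => n; rewrite subrK.
apply: cvgD => //; apply: norm_cvg0.
pose m n := max_weight n.
pose U n := \sum_(0 <= k < n) (center_scale n * erw_weight n k.+1) ^+ 2
      * erw_dev y k + (4 * B * m n + B ^+ 2 * m n ^+ 2) * v n.
apply: (@squeeze_cvgr _ _ _ _ (cst 0) U).
- near=> n; rewrite normr_ge0/=.
  apply: erw_E_cos_le => //; first exact: center_scale_ge0.
  by move=> k kn; exact: scaled_weight_le.
- exact: cvg_cst.
set Q := erw_center_var * _ in vc.
rewrite (_ : 0 = 0 + (4 * B * 0 + B ^+ 2 * 0) * Q); last by ring.
apply: cvgD.
  by apply: scaled_weight_sum_cvg0; [exact: erw_dev_ge0|exact: erw_dev_cvg0].
apply: cvgM => //; apply: cvgD; apply: cvgMr; first exact: max_weight_cvg0.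
exact: max_weight_sqr_cvg0.
Unshelve. all: by end_near. Qed.

(** * Projections of the walk on a fixed vector *)

Lemma dotvD (th x1 x2 : 'rV[R]_d) : dotv th (x1 + x2) = dotv th x1 + dotv th x2.
Proof. by rewrite -big_split; apply: eq_bigr => i _; rewrite mxE mulrDr. Qed.

Lemma dotvZ (th x : 'rV[R]_d) (c : R) : dotv th (c *: x) = c * dotv th x.
Proof. by rewrite /dotv mulr_sumr; apply: eq_bigr => i _; rewrite mxE mulrCA. Qed.

Lemma dotv0 (th : 'rV[R]_d) : dotv th 0 = 0.
Proof. by rewrite /dotv big1// => i _; rewrite mxE mulr0. Qed.

Lemma dotv_delta (x : 'rV[R]_d) j : dotv (delta_mx 0 j) x = x 0 j.
Proof.
rewrite /dotv (bigD1 j)//= !mxE !eqxx mul1r big1 ?addr0// => i ij.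
by rewrite !mxE (negbTE ij) mul0r.
Qed.

Definition dir_proj (th : 'rV[R]_d) (u : dir) : R := dotv th (dvec R u).

Lemma dir_projE th u : dir_proj th u = (if u.2 then -1 else 1) * th 0 u.1.
Proof.
rewrite /dir_proj /dvec dotvZ; congr (_ * _).
rewrite /dotv (bigD1 u.1)//= !mxE !eqxx mulr1 big1 ?addr0// => i ij.
by rewrite !mxE (negbTE ij) mulr0.
Qed.

Lemma dir_avg_proj th : dir_avg (dir_proj th) = 0.
Proof.
rewrite /dir_avg (eq_bigr (fun u : dir => (if u.2 then -1 else 1) * th 0 u.1)).
  rewrite -(pair_bigA _ (fun (i : 'I_d) (b : bool) =>
    (if b then -1 else 1) * th 0 i))/=.
  by rewrite big1 ?mul0r// => i _; rewrite big_bool/= mulN1r mul1r addrC subrr.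
by move=> u _; exact: dir_projE.
Qed.

Lemma dir_avg_proj_sqr th :
  dir_avg (fun u => dir_proj th u ^+ 2) = (\sum_i th 0 i ^+ 2) / d%:R.
Proof.
rewrite /dir_avg (eq_bigr (fun u : dir => th 0 u.1 ^+ 2)).
  rewrite -(pair_bigA _ (fun (i : 'I_d) (b : bool) => th 0 i ^+ 2))/=.
  rewrite (eq_bigr (fun i => 2 * th 0 i ^+ 2)); last first.
    by move=> i _; rewrite big_bool/= mulr_natl mulr2n.
  rewrite -mulr_sumr -mul2n natrM; move: (\sum_i _) => S.
  by field; rewrite pnatr_eq0 -lt0n.
move=> u _; rewrite dir_projE; case: (u.2).
  by rewrite mulN1r sqrrN.
by rewrite mul1r.
Qed.

Lemma path_sum_take (g : dir -> R) n (t : n.-tuple dir) k : (k <= n)%N ->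
  path_sum g (take k t) = \sum_(j < n | (j < k)%N) g (tnth t j).
Proof.
move=> kn; pose u0 : dir := (Ordinal d0, true).
rewrite (eq_bigr (fun j : 'I_n => g (nth u0 t j))); last first.
  by move=> j _; rewrite (tnth_nth u0).
rewrite -(big_ord_widen n (fun j => g (nth u0 t j)) kn).
rewrite /path_sum (big_nth u0) size_takel ?size_tuple// big_mkord.
by apply: eq_bigr => j _; rewrite nth_take.
Qed.

Lemma dotv_scaled_center th n (t : n.-tuple dir) :
  dotv th ((Num.sqrt n%:R)^-1 *: erw_center R t) =
  center_scale n * path_cumsum (dir_proj th) t.
Proof.
have dotv_sum := big_morph (dotv th) (dotvD th) (dotv0 th).
rewrite /erw_center !dotvZ mulrA -/(center_scale n); congr (_ * _).
rewrite dotv_sum /path_cumsum size_tuple; apply: eq_big_nat => k /andP[_ kn].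
by rewrite path_sum_take// /erw_pos dotv_sum.
Qed.

(** * From trigonometric to bounded continuous test functions *)

Let s2 : R := 2 / (3 * (1 - 2 * a) * (2 - a) * d%:R).

Let s2E : s2 = erw_center_var / d%:R.
Proof. by rewrite /s2 /erw_center_var invfM mulrA. Qed.

Let s2gt0 : 0 < s2.
Proof. by rewrite divr_gt0// !mulr_gt0// ltr0n. Qed.

Let sqrt_s2gt0 : 0 < Num.sqrt s2. Proof. by rewrite sqrtr_gt0. Qed.

Lemma erw_expect_trig_cvg (F : 'rV[R]_d -> R) : trig F ->
  erw_expect_scaled_center p F @ \oo --> gauss_expect (Num.sqrt s2) F.
Proof.
elim=> [th b|f g tf fc tg gc|c f tf fc].
- rewrite gauss_expect_cos// sqr_sqrtr ?ltW//.
  rewrite (_ : erw_expect_scaled_center p _ = fun n =>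
    erw_E n (fun h => cos (b + center_scale n * path_cumsum (dir_proj th) h))); last first.
    by apply/funext => n; apply: eq_bigr => t _; rewrite dotv_scaled_center.
  have := erw_E_cos_cvg (b := b) (dir_avg_proj th); rewrite dir_avg_proj_sqr.
  by rewrite (_ : s2 * _ = erw_center_var * ((\sum_i th 0 i ^+ 2) / d%:R)) // s2E mulrAC mulrA.
- rewrite /gauss_expect gauss_iterD//; try exact: bseq_cont_trig.
  rewrite (_ : erw_expect_scaled_center p _ = fun n =>
     erw_expect_scaled_center p f n + erw_expect_scaled_center p g n); last first.
    apply/funext => n; rewrite -big_split; apply: eq_bigr => t _.
    by rewrite mulrDr.
  exact: cvgD.
- rewrite /gauss_expect gauss_iterZ//; last exact: bseq_cont_trig.
  rewrite (_ : erw_expect_scaled_center p _ = fun n =>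
     c * erw_expect_scaled_center p f n); last first.
    apply/funext => n; rewrite /erw_expect_scaled_center mulr_sumr.
    by apply: eq_bigr => t _; rewrite mulrCA.
  exact: cvgMr.
Qed.

Lemma erw_expect_le (f g : 'rV[R]_d -> R) n : (forall x, f x <= g x) ->
  erw_expect_scaled_center p f n <= erw_expect_scaled_center p g n.
Proof. by move=> fg; apply: ler_sum => t _; rewrite ler_wpM2l ?erw_prob_ge0. Qed.

Lemma erw_expect_norm_sub (f g : 'rV[R]_d -> R) n :
  `|erw_expect_scaled_center p f n - erw_expect_scaled_center p g n| <=
  erw_expect_scaled_center p (fun x => `|f x - g x|) n.
Proof.
rewrite -sumrB (le_trans (ler_norm_sum _ _ _))//; apply: ler_sum => t _.
by rewrite -mulrBr normrM ger0_norm// erw_prob_ge0.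
Qed.

(** Tightness: each coordinate is a projection whose second moment converges. *)
Lemma erw_expect_sqr_bounded : exists2 C : R, 0 <= C & forall n,
  erw_expect_scaled_center p (fun x : 'rV[R]_d => \sum_j x 0 j ^+ 2) n <= C.
Proof.
have : forall j : 'I_d, exists C : R, forall n,
    erw_expect_scaled_center p (fun x : 'rV[R]_d => x 0 j ^+ 2) n <= C.
  move=> j; pose y := dir_proj (delta_mx 0 j).
  have h : cvgn (fun n => center_scale n ^+ 2 *
      erw_E n (fun h => path_cumsum y h ^+ 2)).
    by apply/cvg_ex; eexists; apply: scaled_var_cvg; exact: dir_avg_proj.
  have [C [_ hC]] := cvg_seq_bounded h.
  exists (C + 1) => n.
  have -> : erw_expect_scaled_center p (fun x : 'rV[R]_d => x 0 j ^+ 2) n =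
      center_scale n ^+ 2 * erw_E n (fun h => path_cumsum y h ^+ 2).
    rewrite -erw_EZ; apply: eq_bigr => t _; rewrite -dotv_delta.
    by rewrite dotv_scaled_center exprMn.
  by apply: le_trans (ler_norm _) _; apply: hC => //; rewrite ltrDl.
move=> /choice[C hC].
have C0 j : 0 <= C j.
  apply: le_trans (hC j 0%N); apply: sumr_ge0 => t _.
  by rewrite mulr_ge0 ?sqr_ge0 ?erw_prob_ge0.
exists (\sum_j C j) => [|n]; first exact: sumr_ge0.
have -> : erw_expect_scaled_center p (fun x : 'rV[R]_d => \sum_j x 0 j ^+ 2) n =
    \sum_j erw_expect_scaled_center p (fun x : 'rV[R]_d => x 0 j ^+ 2) n.
  rewrite exchange_big/=; apply: eq_bigr => t _.
  by rewrite mulr_sumr.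
by apply: ler_sum.
Qed.

Lemma erw_center_clt (f : 'rV[R]_d -> R) : continuous f ->
  (exists M : R, forall x, `|f x| <= M) ->
  erw_expect_scaled_center p f @ \oo --> gauss_expect (Num.sqrt s2) f.
Proof.
move=> cf [M fM].
have M0 : 0 <= M by exact: le_trans (fM 0).
have bf : bseq_cont f by split; [exact: continuous_cont_cvg|exists M].
have /choice[F hF] : forall m : nat, exists F : 'rV[R]_d -> R,
    [/\ trig F, (forall x, `|F x| <= M) &
    forall x : 'rV[R]_d, (forall j, `|x 0 j| <= m.+1%:R) -> `|F x - f x| <= m.+1%:R^-1].
  by move=> m; apply: trig_approx => //; rewrite ?invr_gt0 ltr0n.
have FM m x : `|F m x| <= M by have [] := hF m.
have hc : (fun m => m.+1%:R^-1 : R) @ \oo --> (0 : R) by exact: cvg_harmonic.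
(* A convergent sequence of arguments is bounded, so it eventually stays in the growing cubes. *)
have Ff : cont_cvg F f.
  move=> u x ux; have fu : (fun n => f (u n)) @ \oo --> f x by exact: bf.1.
  rewrite -[X in _ --> X]add0r.
  rewrite (_ : (fun n => F n (u n)) = fun n => (F n (u n) - f (u n)) + f (u n)); last first.
    by apply/funext => n; rewrite subrK.
  apply: cvgD => //; apply: norm_cvg0.
  apply: (@squeeze_cvgr _ _ _ _ (cst 0) (fun n => n.+1%:R^-1)) => //; last exact: cvg_cst.
  have ub : \forall n \near \oo, forall j, `|u n 0 j| <= n.+1%:R.
    apply: filter_forall => j; have uj := ux j.
    have h : cvgn (fun n => u n 0 j) by apply/cvg_ex; exists (x 0 j).
    have [C [_ hC]] := cvg_seq_bounded h.
    near=> n; apply: (@le_trans _ _ (C + 1)).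
      by apply: hC => //; rewrite ltrDl.
    apply: (@le_trans _ _ n%:R); last by rewrite ler_nat.
    by near: n; exact: nbhs_infty_ger.
  by apply: filterS ub => n hn; rewrite normr_ge0/=; have [_ _] := hF n; apply.
have gF : (fun m => gauss_expect (Num.sqrt s2) (F m)) @ \oo -->
    gauss_expect (Num.sqrt s2) f.
  have bF m : bseq_cont (F m) by apply: bseq_cont_trig; have [] := hF m.
  have h := gauss_iter_cont_cvg (s := Num.sqrt s2) (l := enum 'I_d) bF bf FM Ff.
  by apply: (h (fun=> 0) 0) => j; exact: cvg_cst.
have [C C0 hC] := erw_expect_sqr_bounded.
have ef m n : `|erw_expect_scaled_center p f n - erw_expect_scaled_center p (F m) n|
    <= m.+1%:R^-1 + 2 * M * C * m.+1%:R^-1.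
  apply: le_trans (erw_expect_norm_sub _ _ _) _.
  (* A majorant of |f - F m|: the first term handles the cube; outside it some |x_j| > m + 1 >= 1,
     so |x|^2 >= m + 1 and the second term exceeds 2M. The resulting bound is uniform in n, so m can
     be fixed before n. *)
  pose g (x : 'rV[R]_d) : R := m.+1%:R^-1 + 2 * M * m.+1%:R^-1 * \sum_j x 0 j ^+ 2.
  have k0 : 0 < m.+1%:R :> R by rewrite ltr0n.
  have i0 : 0 < m.+1%:R^-1 :> R by rewrite invr_gt0.
  have S0 (x : 'rV[R]_d) : 0 <= \sum_j x 0 j ^+ 2.
    by apply: sumr_ge0 => j _; exact: sqr_ge0.
  apply: (@le_trans _ _ (erw_expect_scaled_center p g n)).
    apply: erw_expect_le => x; rewrite /g.
    have [xK|] := pselect (forall j, `|x 0 j| <= m.+1%:R).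
      rewrite distrC; have [_ _ hx] := hF m; apply: le_trans (hx x xK) _.
      by rewrite lerDl mulr_ge0// mulr_ge0// ?mulr_ge0// ltW.
    move=> /existsNP[j /negP]; rewrite -ltNge => xj.
    rewrite -[leLHS]add0r; apply: lerD; first exact: ltW.
    apply: (@le_trans _ _ (2 * M)).
      by rewrite mulr_natl mulr2n (le_trans (ler_normB _ _))// lerD.
    rewrite -mulrA ler_peMr ?mulr_ge0// mulrC ler_pdivlMr// mul1r.
    rewrite (bigD1 j)//= -[leLHS]addr0 lerD//; last first.
      by apply: sumr_ge0 => i _; exact: sqr_ge0.
    rewrite -real_normK ?num_real// expr2 (le_trans (ltW xj))// ler_peMr//.
    by rewrite (le_trans _ (ltW xj))// ler1n.
  have -> : erw_expect_scaled_center p g n = m.+1%:R^-1 + 2 * M * m.+1%:R^-1 *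
      erw_expect_scaled_center p (fun x : 'rV[R]_d => \sum_j x 0 j ^+ 2) n.
    transitivity (erw_E n (fun=> m.+1%:R^-1) + 2 * M * m.+1%:R^-1 *
      erw_expect_scaled_center p (fun x : 'rV[R]_d => \sum_j x 0 j ^+ 2) n).
      rewrite /erw_expect_scaled_center /erw_E mulr_sumr -big_split.
      by apply: eq_bigr => t _ /=; rewrite /g mulrDr [in RHS]mulrCA.
    by rewrite erw_E_cst.
  rewrite lerD2l [leRHS]mulrAC; apply: ler_wpM2l; last exact: hC.
  by apply: mulr_ge0; [exact: mulr_ge0|exact: ltW].
apply/cvgrPdist_le => /= e e0.
have e3 : 0 < e / 3 by rewrite divr_gt0.
have [m [hm1 hm2]] : exists m, `|gauss_expect (Num.sqrt s2) f -
     gauss_expect (Num.sqrt s2) (F m)| <= e / 3 /\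
     m.+1%:R^-1 + 2 * M * C * m.+1%:R^-1 <= e / 3.
  have h : (fun m => m.+1%:R^-1 + 2 * M * C * m.+1%:R^-1) @ \oo --> (0 : R).
    rewrite (_ : 0 = 0 + 2 * M * C * 0); last by rewrite mulr0 addr0.
    by apply: cvgD => //; exact: cvgMr.
  have [N1 _ H1] := (cvgrPdist_le _ _).1 gF _ e3.
  have [N2 _ H2] := (cvgrPdist_le _ _).1 h _ e3.
  exists (maxn N1 N2); split; first by apply: H1; exact: leq_maxl.
  have := H2 _ (leq_maxr N1 N2); rewrite /= sub0r normrN.
  exact: le_trans (ler_norm _).
have tF : trig (F m) by have [] := hF m.
have [N _ HN] := (cvgrPdist_le _ _).1 (erw_expect_trig_cvg tF) _ e3.
exists N => // n /= /HN hn.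
have := le_trans (ef m n) hm2; rewrite distrC => h4.
move: hm1 hn h4; set x1 := gauss_expect _ f; set x2 := gauss_expect _ (F m).
set x3 := erw_expect_scaled_center p (F m) n; set x4 := erw_expect_scaled_center p f n.
move=> h1 h2 h4.
have -> : x1 - x4 = (x1 - x2) + (x2 - x3) + (x3 - x4) by ring.
apply: le_trans (ler_normD _ _) _.
apply: le_trans (lerD (ler_normD _ _) (lexx _)) _.
have -> : e = e / 3 + e / 3 + e / 3 by field.
by rewrite !lerD.
Unshelve. all: by end_near. Qed.

End ElephantExpectation.

(* Convergence in distribution of G_n / sqrt n to N(0, sigma2 I_d), with
   sigma2 = 2 / (3 (1 - 2a) (2 - a) d), a = (2dp - 1)/(2d - 1):
   E[f(G_n / sqrt n)] -> E[f(Z)] for every bounded continuous f. *)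
Theorem theorem2p3 (R : realType) (d : nat) (p : R) :
  (0 < d)%N -> 0 <= p -> p <= 1 ->
  p < (d.*2 + 1)%:R / (d * 4)%:R ->
  let a := ((d.*2)%:R * p - 1) / (d.*2 - 1)%:R in
  let sigma2 := 2 / (3 * (1 - 2 * a) * (2 - a) * d%:R) in
  forall f : 'rV[R]_d -> R, continuous f ->
  (exists M : R, forall x, `|f x| <= M) ->
  erw_expect_scaled_center p f @ \oo --> gauss_expect (Num.sqrt sigma2) f.
Proof.
move=> d0 p0 p1 pd a sigma2 f.
apply: (erw_center_clt d0 p0 p1); rewrite /erw_mem.
have D0 : 0 < d%:R :> R by rewrite ltr0n.
have D1 : 1 <= d%:R :> R by rewrite ler1n.
(* What remains is 2a < 1, equivalent to p < (2d+1)/(4d) after clearing the positive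
   denominators. *)
rewrite natrB ?double_gt0// -mul2n natrM.
move: pd; rewrite -mul2n natrD !natrM ltr_pdivlMr ?mulr_gt0//.
have D2 : 0 < 2 * d%:R - 1 :> R by lra.
rewrite mulrA ltr_pdivrMr//; lra.
Qed.
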